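(* Let $k,\ell\in \mathbb{N}_{\geq 2}$ be multiplicatively independent. Then the first-order theory $\mathrm{FO}(\mathbb{N},+,k^{\mathbb{N}},\ell^{\mathbb{N}})$ is undecidable.
   Context: $\mathbb{N}$ contains $0$. $k$ and $\ell$ are multiplicatively independent if $k^a\neq \ell^b$ for all nonzero $a,b\in\mathbb{Z}$. For $k\geq 2$, $k^{\mathbb{N}}=\{k^i: i\in\mathbb{N}\}$, viewed as a unary predicate. $\mathrm{FO}(\mathbb{N},+,k^{\mathbb{N}},\ell^{\mathbb{N}})$ denotes the set of first-order sentences true in the structure $(\mathbb{N},+,k^{\mathbb{N}},\ell^{\mathbb{N}})$. *)

(* Defs.v *)
From mathcomp Require Import all_boot all_order all_algebra.
From Stdlib Require Cantor.
Set Implicit Arguments.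
Unset Strict Implicit.
Unset Printing Implicit Defensive.
Import GRing.Theory Num.Theory.

(* The powers are taken in [rat], so that negative exponents make sense. *)
Definition multiplicatively_independent (k l : nat) : Prop :=
  forall a b : int, a <> 0%R -> b <> 0%R ->
    ((k%:R : rat) ^ a)%R <> ((l%:R : rat) ^ b)%R.

Definition powers (k : nat) : nat -> Prop := fun n => exists i : nat, n = k ^ i.

(* First-order logic with equality over the signature consisting of a binary
   function symbol [+] and two unary predicate symbols [P] and [Q].  Variables
   are de Bruijn indices: [Var i] refers to the [i]-th enclosing quantifier,
   counted from the inside and starting at 0. *)
Inductive term : Type :=
  | Var of nat
  | Add of term & term.

Inductive formula : Type :=
  | FEq of term & term
  | FP of term
  | FQ of term
  | FNot of formula
  | FAnd of formula & formula
  | FOr of formula & formula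
  | FImp of formula & formula
  | FAll of formula
  | FEx of formula.

Fixpoint term_below (n : nat) (t : term) : bool :=
  match t with
  | Var i => i < n
  | Add s t => term_below n s && term_below n t
  end.

(* All free variables of the formula are among [Var 0], ..., [Var n.-1]. *)
Fixpoint free_below (n : nat) (phi : formula) : bool :=
  match phi with
  | FEq s t => term_below n s && term_below n t
  | FP t | FQ t => term_below n t
  | FNot f => free_below n f
  | FAnd f g | FOr f g | FImp f g => free_below n f && free_below n g
  | FAll f | FEx f => free_below n.+1 f
  end.

Definition sentence (phi : formula) : bool := free_below 0 phi.

Definition scons (a : nat) (v : nat -> nat) : nat -> nat :=
  fun i => if i is j.+1 then v j else a.

Fixpoint eval (v : nat -> nat) (t : term) : nat :=
  match t with
  | Var i => v i
  | Add s t => eval v s + eval v t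
  end.

(* Satisfaction in the structure (nat, +, P, Q) under the assignment [v]. *)
Fixpoint sat (P Q : nat -> Prop) (v : nat -> nat) (phi : formula) : Prop :=
  match phi with
  | FEq s t => eval v s = eval v t
  | FP t => P (eval v t)
  | FQ t => Q (eval v t)
  | FNot f => ~ sat P Q v f
  | FAnd f g => sat P Q v f /\ sat P Q v g
  | FOr f g => sat P Q v f \/ sat P Q v g
  | FImp f g => sat P Q v f -> sat P Q v g
  | FAll f => forall a, sat P Q (scons a v) f
  | FEx f => exists a, sat P Q (scons a v) f
  end.

(* The set of sentences true in (nat, +, P, Q); the truth value of a sentence
   does not depend on the assignment. *)
Definition FO (P Q : nat -> Prop) : formula -> Prop :=
  fun phi => sentence phi /\ forall v, sat P Q v phi.

(* Goedel numbering by Cantor pairing; the first component is a tag for the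
   head constructor. *)
Definition cpair (a b : nat) : nat := Cantor.to_nat (a, b).

Fixpoint code_term (t : term) : nat :=
  match t with
  | Var i => cpair 0 i
  | Add s t => cpair 1 (cpair (code_term s) (code_term t))
  end.

Fixpoint code (phi : formula) : nat :=
  match phi with
  | FEq s t => cpair 0 (cpair (code_term s) (code_term t))
  | FP t => cpair 1 (code_term t)
  | FQ t => cpair 2 (code_term t)
  | FNot f => cpair 3 (code f)
  | FAnd f g => cpair 4 (cpair (code f) (code g))
  | FOr f g => cpair 5 (cpair (code f) (code g))
  | FImp f g => cpair 6 (cpair (code f) (code g))
  | FAll f => cpair 7 (code f)
  | FEx f => cpair 8 (code f)
  end.

Lemma cpair_inj (a b c d : nat) : cpair a b = cpair c d -> a = c /\ b = d.
Proof. by move=> /Cantor.to_nat_inj []. Qed.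

Lemma code_term_inj : injective code_term.
Proof.
elim=> [i|s IHs t IHt] [j|s' t'] //= /cpair_inj [] // _.
  by move=> ->.
by move=> /cpair_inj [/IHs -> /IHt ->].
Qed.

Lemma code_inj : injective code.
Proof.
elim=> [s t|t|t|f IHf|f IHf g IHg|f IHf g IHg|f IHf g IHg|f IHf|f IHf]
  [s' t'|t'|t'|f'|f' g'|f' g'|f' g'|f'|f'] //= /cpair_inj [] // _;
  do ?[by move=> /code_term_inj -> | by move=> /IHf ->
      |by move=> /cpair_inj [/code_term_inj -> /code_term_inj ->]
      |by move=> /cpair_inj [/IHf -> /IHg ->]].
Qed.

(* The (total) recursive functions: the least class of functions that contains
   zero, the successor and the projections, and is closed under composition,
   primitive recursion and minimisation of regular functions.  Closure under
   extensional equality is built into the constructors. *)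
Inductive recursive : forall n : nat, (n.-tuple nat -> nat) -> Prop :=
  | rec_zero n (h : n.-tuple nat -> nat) :
      (forall x, h x = 0) -> recursive h
  | rec_succ (h : 1.-tuple nat -> nat) :
      (forall x, h x = (thead x).+1) -> recursive h
  | rec_proj n (i : 'I_n) (h : n.-tuple nat -> nat) :
      (forall x, h x = tnth x i) -> recursive h
  | rec_comp m n (f : m.-tuple nat -> nat) (g : 'I_m -> n.-tuple nat -> nat)
        (h : n.-tuple nat -> nat) :
      recursive f -> (forall i, recursive (g i)) ->
      (forall x, h x = f [tuple g i x | i < m]) -> recursive h
  | rec_prec n (f : n.-tuple nat -> nat) (g : n.+2.-tuple nat -> nat)
        (h : n.+1.-tuple nat -> nat) :
      recursive f -> recursive g ->
      (forall x, h (cons_tuple 0 x) = f x) ->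
      (forall y x, h (cons_tuple y.+1 x)
                   = g (cons_tuple y (cons_tuple (h (cons_tuple y x)) x))) ->
      recursive h
  | rec_min n (f : n.+1.-tuple nat -> nat) (h : n.-tuple nat -> nat) :
      recursive f ->
      (forall x, f (cons_tuple (h x) x) = 0) ->
      (forall x y, y < h x -> f (cons_tuple y x) <> 0) ->
      recursive h.

Definition recursive_set (A : nat -> Prop) : Prop :=
  exists2 chi : 1.-tuple nat -> nat, recursive chi &
    forall n, (A n -> chi [tuple n] = 1) /\ (~ A n -> chi [tuple n] = 0).

Definition decidable_theory (T : formula -> Prop) : Prop :=
  recursive_set (fun n => exists2 phi, T phi & n = code phi).

(* Main.v *)
Require Import Defs.
From mathcomp Require Import all_boot all_order all_algebra.
From mathcomp Require Import zify.
From Stdlib Require Import Classical FunctionalExtensionality.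
Set Implicit Arguments.
Unset Strict Implicit.
Unset Printing Implicit Defensive.

(* Fix [c = k ^ M] and look at those [x = k ^ (M + i)] that lie just above a
   power [y] of [l], namely [0 <= x - y < c * b].  Multiplicative independence
   makes the quotients of powers of [k] and [l] dense, so [M] can be chosen
   such that these [x], in increasing order, have differences
   [c * k ^ a <= x - y < c * k ^ a + c] for any prescribed finite sequence of
   exponents [a].  Four parameters thus code an arbitrary finite sequence of
   numbers, hence an arbitrary finite set of finite tuples.

   The graph of a recursive function is witnessed by a finite set of claims
   "the j-th function takes the value y at x" in which each claim is justified
   by other ones, and "there are parameters coding such a set" is first-order.
   A decision procedure for the theory would itself be a recursive function,
   and the usual diagonal sentence refutes it. *)

(** * Density of quotients of powers *)

(** The obstacle is less to produce the prescribed differences than to exclude all others: any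
    further power of [k] just above a power of [l] would insert an unwanted entry. So the powers of
    [l] are scaled by a factor [theta], at each stage a quotient [k ^ I / l ^ J]. The difference at
    [I] is then exactly 0, and lowering [theta] slightly opens it to the wanted size, while older
    differences move within a reserve kept for them. Choosing the next quotient with least exponent
    of [k] keeps unwanted entries out. At the end [theta] is replaced by a quotient [l ^ N / k ^ M];
    multiplication by [c = k ^ M] then yields differences of true powers, at the price of the
    tolerance [c]. With addition as the only operation, a number [a] is handled through
    [c * k ^ a.+1], whose successor is a multiplication by the constant [k]. Traces need only
    successor, equality and order of numbers, so multiplication never has to be defined. The
    parameters are quantified existentially and may code anything; the formula therefore demands all
    rules explicitly, and these alone make every claim true. *)

Lemma indep_expn_neq (k l : nat) : 2 <= k -> 2 <= l ->
  multiplicatively_independent k l -> forall q n, 0 < q -> k ^ q <> l ^ n.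
Proof.
move=> hk hl hkl q [|n] q_gt0 e.
  by have := ltn_expl q hk; rewrite e expn0; case: q q_gt0 {e}.
apply: (hkl (Posz q) (Posz n.+1)); [by case: q q_gt0 {e}|by []|].
by rewrite -!ssrint.exprnP -!GRing.natrX e.
Qed.

(** Bernoulli's inequality [(1 + 1/x)^s >= 1 + s/x] with denominators cleared; [s = C * x] turns the
    right side into [1 + C]. *)
Lemma mul_expn_lt_expn (x y C : nat) : 0 < x -> x < y -> exists s, C * x ^ s < y ^ s.
Proof.
move=> x_gt0 lt_xy; exists (C * x).
have bern s : (x + s) * x ^ s <= x * y ^ s.
  elim: s => [|s IHs]; first by rewrite addn0.
  rewrite !expnS.
  have : x ^ s <= y ^ s by case: (s) => // s'; rewrite leq_exp2r // ltnW.
  nia.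
have := bern (C * x); have : 0 < x ^ (C * x) by rewrite expn_gt0 x_gt0.
nia.
Qed.

Section PowersOfTwoBases.
Variables (k l : nat).
Hypotheses (hk : 2 <= k) (hl : 2 <= l).
Hypothesis expn_neq : forall q n, 0 < q -> k ^ q <> l ^ n.

Lemma expk_gt0 i : 0 < k ^ i. Proof. by rewrite expn_gt0; case: k hk. Qed.
Lemma expl_gt0 i : 0 < l ^ i. Proof. by rewrite expn_gt0; case: l hl. Qed.

(** Dirichlet's box principle: [k ^ t / l ^ e t] lies in [[1, l)], so [g t] takes at most [l * T]
    values and two of [l * T + 1] exponents share one. The quotient of their two ratios is within
    [1/T] of 1. *)
Lemma close_powers T : 0 < T -> exists a b,
  [/\ 0 < a, T * k ^ a < T.+1 * l ^ b & T * l ^ b < T * k ^ a + l ^ b].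
Proof.
move=> T_gt0; pose e t := trunc_log l (k ^ t).
have eP t : l ^ e t <= k ^ t < l ^ (e t).+1 by apply: trunc_log_bounds => //; apply: expk_gt0.
pose g t := (k ^ t * T) %/ l ^ e t.
have gP t : g t * l ^ e t <= k ^ t * T < (g t).+1 * l ^ e t.
  by rewrite /g leq_divM /= ltn_ceil // expl_gt0.
have g_lt t : g t < l * T.
  rewrite /g ltn_divLR ?expl_gt0 //; case/andP: (eP t) => _; rewrite expnS.
  by move=> lt; rewrite mulnAC ltn_mul2r T_gt0.
pose G (t : 'I_(l * T).+1) : 'I_(l * T) := Ordinal (g_lt t).
have [t [t' [lt_tt' eqg]]] : exists t t' : nat, t < t' /\ g t = g t'.
  have /injectivePn [t [t' ne eqG]] : ~~ injectiveb G.
    by apply/negP => /injectiveP /leq_card; rewrite !card_ord ltnn.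
  have {}eqG : g t = g t' by have := congr1 val eqG.
  by case: (ltngtP t t') => [lt|lt|/val_inj eq]; [exists t, t' | exists t', t | rewrite eq eqxx in ne].
have le_e : e t <= e t' by apply: leq_trunc_log; rewrite leq_pexp2l // ltnW.
exists (t' - t), (e t' - e t); rewrite subn_gt0 lt_tt'.
have Ek : k ^ t' = k ^ t * k ^ (t' - t) by rewrite -expnD subnKC // ltnW.
have El : l ^ e t' = l ^ e t * l ^ (e t' - e t) by rewrite -expnD subnKC.
move: (gP t) (gP t') (eP t) => /andP[g1 g2] /andP[]; rewrite -eqg Ek El.
move: (expk_gt0 t) (expl_gt0 (e t)) (expk_gt0 (t' - t)) (expl_gt0 (e t' - e t)) => X0 Y0 A0 B0.
move: (k ^ t) (l ^ e t) (k ^ (t' - t)) (l ^ (e t' - e t)) (g t) g1 g2 X0 Y0 A0 B0.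
move=> X Y a b c g1 g2 X0 Y0 a0 b0 g3 g4 /andP[eX _]; split=> //.
- rewrite -(ltn_pmul2l X0).
  have : c.+1 * Y * b <= (X * T + X) * b by rewrite leq_pmul2r //; nia.
  nia.
- rewrite -(ltn_pmul2l X0).
  have : X * T * b < c.+1 * Y * b by rewrite ltn_pmul2r.
  have : Y * b <= X * b by rewrite leq_pmul2r.
  nia.
Qed.

(** For [T = v] the ratio [rho = k ^ a / l ^ b] is within [1/v] of 1 and, by independence, not equal
    to 1. Repeated multiplication by [rho], started outside [(u, v)], must hit this interval,
    because [v * (1 - 1/v) >= u] and [u * (1 + 1/v) < v] forbid jumping over it. *)
Lemma power_ratio_dense u v w Q : 0 < u -> u < v -> 0 < w ->
  exists q n, [/\ Q <= q, u * l ^ n < w * k ^ q & w * k ^ q < v * l ^ n].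
Proof.
move=> u_gt0 lt_uv w_gt0; have v_gt0 : 0 < v by apply: leq_trans lt_uv.
have [a [b [a_gt0 up lo]]] := close_powers v_gt0.
have X0 := expk_gt0 a; have Y0 := expl_gt0 b.
case: (ltngtP (k ^ a) (l ^ b)) => [lt|lt|/(expn_neq a_gt0) //].
(* Descending case: the extra exponent [v] puts the start above [v], as [k ^ v > v]. *)
- pose p s := w * k ^ (Q + v + a * s) < v * l ^ (b * s).
  have ex : exists s, p s.
    have [s hs] := mul_expn_lt_expn (w * k ^ (Q + v)) X0 lt; exists s.
    rewrite /p expnD mulnA !expnM; apply: leq_trans hs _.
    by rewrite leq_pmull.
  case: (ex_minnP ex) => -[|s] ps min_s.
    move: ps; rewrite /p !muln0 addn0 expn0 muln1 => le; exfalso.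
    have : k ^ v <= k ^ (Q + v) by rewrite leq_pexp2l ?leq_addl // ltnW.
    have := ltn_expl v hk; nia.
  exists (Q + v + a * s.+1), (b * s.+1); split=> //; first by rewrite -addnA leq_addr.
  have : ~~ p s by apply/negP => /min_s; rewrite ltnn.
  rewrite /p -leqNgt !mulnSr addnA !expnD.
  set X := k ^ Q * _ * _; set Y := l ^ (b * s) => le.
  have Y1 : 0 < Y by apply: expl_gt0.
  have : u * l ^ b < v * k ^ a by nia.
  rewrite -(ltn_pmul2r Y1) => lt1.
  have : v * Y * k ^ a <= w * X * k ^ a by rewrite leq_mul2r le orbT.
  lia.
- have [n0 hn0] : exists n0, w * k ^ Q <= u * l ^ n0.
    exists (w * k ^ Q); apply: leq_trans (ltnW (ltn_expl _ hl)) _; exact: leq_pmull.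
  pose p s := u * l ^ (n0 + b * s) < w * k ^ (Q + a * s).
  have ex : exists s, p s.
    have [s hs] := mul_expn_lt_expn (u * l ^ n0) Y0 lt; exists s.
    rewrite /p !expnD mulnA !expnM; apply: leq_trans hs _.
    by rewrite mulnA leq_pmull // muln_gt0 w_gt0 expk_gt0.
  case: (ex_minnP ex) => -[|s] ps min_s.
    by move: ps; rewrite /p !muln0 !addn0 ltnNge hn0.
  exists (Q + a * s.+1), (n0 + b * s.+1); split=> //; first by rewrite leq_addr.
  have : ~~ p s by apply/negP => /min_s; rewrite ltnn.
  rewrite /p -leqNgt !mulnSr !addnA !expnD.
  set X := k ^ Q * _; set Y := l ^ n0 * _ => le.
  have Y1 : 0 < Y by rewrite muln_gt0 !expl_gt0.
  have : u * (v * k ^ a) < v * (v * l ^ b).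
    have : u * (v * k ^ a) < u * (v.+1 * l ^ b) by rewrite ltn_pmul2l.
    nia.
  rewrite mulnCA ltn_pmul2l // -(ltn_pmul2r Y1) => lt1.
  have : w * X * k ^ a <= u * Y * k ^ a by rewrite leq_mul2r le orbT.
  lia.
Qed.

End PowersOfTwoBases.

(** * Coding finite sequences *)

Section NextApproximation.
Variables (k l : nat).
Hypotheses (hk : 2 <= k) (hl : 2 <= l).
Hypothesis expn_neq : forall q n, 0 < q -> k ^ q <> l ^ n.

Let K0 := expk_gt0 hk.
Let L0 := expl_gt0 hl.

Lemma expl_lt_double m n : m < n -> 2 * l ^ m <= l ^ n.
Proof.
move=> lt_mn; apply: leq_trans (_ : l ^ m.+1 <= _); last by rewrite leq_pexp2l // ltnW.
by rewrite expnS leq_mul2r hl orbT.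
Qed.

Lemma expk_lt_double m n : m < n -> 2 * k ^ m <= k ^ n.
Proof.
move=> lt_mn; apply: leq_trans (_ : k ^ m.+1 <= _); last by rewrite leq_pexp2l // ltnW.
by rewrite expnS leq_mul2r hk orbT.
Qed.

(* The least admissible [q] works: a [p < q] violating the last clause would
   itself be admissible, because the upper bound on [k ^ q / l ^ n] is relaxed
   by [2 * b / (k ^ I * l ^ n)]. *)
Lemma next_approximation I a b : 16 * (b * b) <= k ^ I -> k ^ a < b ->
  exists q n,
  [/\ 0 < q, k ^ q < l ^ n, 8 * b <= l ^ n
    & [/\ k ^ I * k ^ q + k ^ a * l ^ n <= k ^ I * l ^ n,
          2 * (k ^ I * l ^ n) <= 2 * (k ^ I * k ^ q) + (2 * k ^ a + 1) * l ^ n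
        & forall p m, 0 < p < q -> k ^ q * l ^ m <= k ^ p * l ^ n ->
            k ^ I * (k ^ q * l ^ m) + b * l ^ n <= k ^ I * (k ^ p * l ^ n)]].
Proof.
set K := k ^ I; set A := k ^ a => leK ltA.
have A0 : 0 < A by apply: K0.
(* With [rho = k ^ q / l ^ n] this reads [A + 1/4 - 2b / l ^ n <= K * (1 - rho) < A + 1/2]; the
   lower bound is at least [A] once [8 * b <= l ^ n]. *)
pose Phi q n := [&& 0 < q, 4 * (K * l ^ n) < 4 * (K * k ^ q) + (4 * A + 2) * l ^ n
  & 4 * (K * k ^ q) + (4 * A + 1) * l ^ n <= 4 * (K * l ^ n) + 8 * b].
have exPhi : exists q n, Phi q n.
  have [|||q [n [q0 lo up]]] := @power_ratio_dense k l hk hl expn_neq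
    (4 * K - (4 * A + 2)) (4 * K - (4 * A + 1)) (4 * K) 1.
  - nia.
  - nia.
  - nia.
  exists q, n; rewrite /Phi q0 /=; move: lo up; rewrite !mulnBl => lo up.
  by apply/andP; split; lia.
have [q [[n]]] : exists q, (exists n, Phi q n) /\ forall p m, p < q -> ~ Phi p m.
  case: exPhi => q; elim/ltn_ind: q => q IH [n Phiqn].
  case: (classic (exists p, p < q /\ exists m, Phi p m)) => [[p [ltpq [m Phipm]]]|no].
    by apply: IH ltpq _; exists m.
  exists q; split; first by exists n.
  by move=> p m ltpq Phipm; apply: no; exists p; split => //; exists m.
rewrite /Phi => /and3P[q0 lo up] min_q.
have Y0 := L0 n; have X0 := K0 q.
have lt_qn : k ^ q < l ^ n.
  case: (ltngtP (k ^ q) (l ^ n)) => [//|lt|/(expn_neq q0) //].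
  have : K * (l ^ n).+1 <= K * k ^ q by rewrite leq_mul2l lt orbT.
  nia.
(* As [k ^ q < l ^ n] are integers, [K / l ^ n <= K * (1 - rho) < A + 1/2], and [K] is at least
   [16 * b^2]. *)
have leY : 8 * b <= l ^ n.
  have : K * (k ^ q).+1 <= K * l ^ n by rewrite leq_mul2l lt_qn orbT.
  move=> le1; rewrite leqNgt; apply/negP => lt1.
  have : (4 * A + 2) * l ^ n <= (4 * b) * (8 * b) by apply: leq_mul; lia.
  lia.
exists q, n; split=> //; split.
- lia.
- lia.
move=> p m /andP[p0 ltpq] le1; rewrite leqNgt; apply/negP => lt2.
have Z0 := L0 m; have W0 := K0 p.
apply: (min_q p m ltpq); rewrite p0 /=.
(* The factor 2 makes the slacks add up: [2b / l ^ n + b / l ^ m <= 2b / l ^ m], the slack allowed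
   at [p]. *)
have ltmn : 2 * l ^ m <= l ^ n.
  apply: expl_lt_double; rewrite ltnNge; apply/negP => le_nm.
  have : l ^ n <= l ^ m by rewrite leq_pexp2l // ltnW.
  have := expk_lt_double ltpq; nia.
apply/andP; split.
- rewrite -(@ltn_pmul2r (l ^ n)) //.
  have e1 : K * (k ^ q * l ^ m) <= K * (k ^ p * l ^ n) by rewrite leq_mul2l le1 orbT.
  have : (4 * (K * l ^ n)) * l ^ m < (4 * (K * k ^ q) + (4 * A + 2) * l ^ n) * l ^ m by rewrite ltn_pmul2r.
  lia.
- rewrite -(@leq_pmul2r (l ^ n)) //.
  have : (4 * (K * k ^ q) + (4 * A + 1) * l ^ n) * l ^ m <= (4 * (K * l ^ n) + 8 * b) * l ^ m by rewrite leq_pmul2r.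
  have : b * (2 * l ^ m) <= b * l ^ n by rewrite leq_mul2l ltmn orbT.
  lia.
Qed.

End NextApproximation.

Section Approximations.
Variables (k l : nat).
Hypotheses (hk : 2 <= k) (hl : 2 <= l).
Hypothesis expn_neq : forall q n, 0 < q -> k ^ q <> l ^ n.

Let K0 := expk_gt0 hk.
Let L0 := expl_gt0 hl.

Section Approximation.
Variables (b i1 : nat).
Hypothesis b_small : 16 * (b * b) <= k ^ i1.
Hypothesis b_gt0 : 0 < b.

(* [k ^ I / l ^ J] approximates the factor [theta] by which powers of [l] are to
   be scaled.  The entries [(i, j, a)] are the pairs with
   [0 <= k ^ i - theta * l ^ j < b], and [a] is the exponent of that difference;
   the term [2 * b * l ^ j] leaves room for the later decrease of [theta]. *)
Definition approximation I J (e : seq (nat * nat * nat)) : Prop :=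
  [/\ i1 <= I, k ^ I <= k ^ i1 * l ^ J, pairwise ltn [seq t.1.1 | t <- e],
      forall i j a, (i, j, a) \in e ->
        [/\ i1 <= i < I, k ^ I * l ^ j + k ^ a * l ^ J <= k ^ i * l ^ J
          & k ^ i * l ^ J + 2 * b * l ^ j <= k ^ I * l ^ j + (k ^ a).+1 * l ^ J]
    & forall i j, i1 <= i < I -> k ^ I * l ^ j <= k ^ i * l ^ J ->
        k ^ i * l ^ J < k ^ I * l ^ j + b * l ^ J -> exists a, (i, j, a) \in e].

(** [theta] is multiplied by [rho = k ^ q / l ^ n]. The difference at [(I, J)] becomes
    [k ^ I * (1 - rho)], between [k ^ a] and [k ^ a + 1/2]; an older entry at [j] moves by at most
    [(k ^ a + 1/2) * l ^ j / l ^ J], paid from its reserve [2b * l ^ j / l ^ J]. *)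
Lemma approximation_rcons I J e a : approximation I J e -> k ^ a < b ->
  exists I' J', approximation I' J' (rcons e (I, J, a)).
Proof.
case=> leI leIJ sorted_e labels_e noise_e ltA.
have leK : 16 * (b * b) <= k ^ I by rewrite (leq_trans b_small) // leq_pexp2l // ltnW.
have [q [n [q0 lt_qn le_bn [lo up noise]]]] := next_approximation hk hl expn_neq leK ltA.
exists (I + q), (J + n).
have lt_n2q : l ^ n < 2 * k ^ q.
  have KI := K0 I; have Y0 := L0 n; rewrite -(ltn_pmul2l KI).
  have : (2 * k ^ a + 1) * l ^ n < k ^ I * l ^ n by rewrite ltn_pmul2r //; nia.
  lia.
split.
- by rewrite (leq_trans leI) // leq_addr.
- by rewrite !expnD mulnA leq_mul // ltnW.
- rewrite map_rcons pairwise_rcons sorted_e andbT; apply/allP => _ /mapP[[[i j] a'] /labels_e [/andP[_ lt] _ _] ->].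
  exact: lt.
- move=> i j a'; rewrite mem_rcons inE => /predU1P[[-> -> ->]|].
    rewrite leI -{1}(addn0 I) ltn_add2l q0 !expnD; have Z0 := L0 J; split=> //.
      have : l ^ J * (k ^ I * k ^ q + k ^ a * l ^ n) <= l ^ J * (k ^ I * l ^ n) by rewrite leq_pmul2l.
      lia.
    have : l ^ J * (2 * (k ^ I * l ^ n)) <= l ^ J * (2 * (k ^ I * k ^ q) + (2 * k ^ a + 1) * l ^ n) by rewrite leq_pmul2l.
    have : l ^ J * (8 * b) <= l ^ J * l ^ n by rewrite leq_pmul2l.
    lia.
  move=> /labels_e[/andP[le1 lt1] lo1 up1]; rewrite le1 ltn_addr //; split=> //; rewrite !expnD.
    have : (k ^ I * l ^ j + k ^ a' * l ^ J) * l ^ n <= k ^ i * l ^ J * l ^ n by rewrite leq_mul2r lo1 orbT.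
    have : k ^ I * l ^ j * k ^ q <= k ^ I * l ^ j * l ^ n by rewrite leq_mul2l (ltnW lt_qn) orbT.
    lia.
  have : (k ^ i * l ^ J + 2 * b * l ^ j) * l ^ n <= (k ^ I * l ^ j + (k ^ a').+1 * l ^ J) * l ^ n.
    by rewrite leq_mul2r up1 orbT.
  have : l ^ j * (2 * (k ^ I * l ^ n)) <= l ^ j * (2 * (k ^ I * k ^ q) + (2 * k ^ a + 1) * l ^ n).
    by rewrite leq_mul2l up orbT.
  have : (2 * k ^ a + 1) * (l ^ n * l ^ j) <= (2 * b) * (l ^ n * l ^ j) by rewrite leq_mul2r; apply/orP; right; lia.
  have : 2 * (b * l ^ j) <= l ^ n * (b * l ^ j) by rewrite leq_mul2r; apply/orP; right; lia.
  lia.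
move=> i j /andP[le1 lt1]; rewrite !expnD => lo1 up1.
have KI := K0 I; have Y0 := L0 n; have X0 := K0 q; have Z0 := L0 J; have W0 := L0 j; have V0 := K0 i.
case: (ltngtP i I) => [lt_iI|lt_Ii|eq_iI].
- have up2 : k ^ i * l ^ J < k ^ I * l ^ j + b * l ^ J.
    rewrite -(ltn_pmul2r Y0).
    have : k ^ I * l ^ j * k ^ q <= k ^ I * l ^ j * l ^ n by rewrite leq_mul2l (ltnW lt_qn) orbT.
    lia.
  case: (leqP (k ^ I * l ^ j) (k ^ i * l ^ J)) => [lo2|lo2].
    have [a' ha'] : exists a', (i, j, a') \in e by apply: noise_e => //; apply/andP.
    by exists a'; rewrite mem_rcons inE ha' orbT.
  (* Now [theta * rho * l ^ j <= k ^ i < theta * l ^ j]. If [j <= J], the gap on the right is a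
     positive multiple of [k ^ i / l ^ (J - j)], more than [theta * l ^ j] can drop. If [j > J],
     then [theta * l ^ j >= 4 * k ^ i], while [rho > 1/2]. *)
  exfalso.
  have leK1 : 16 * (b * b) <= k ^ i by rewrite (leq_trans b_small) // leq_pexp2l // ltnW.
  have bb : b <= b * b by rewrite leq_pmulr.
  case: (leqP j J) => [le_jJ|lt_Jj].
    move: lo2 lo1 up1; rewrite -(subnKC (ltnW lt_iI)) -(subnKC le_jJ) !expnD => lo2 lo1 up1.
    have h1 : l ^ (J - j) < k ^ (I - i).
      by rewrite -(@ltn_pmul2l (k ^ i * l ^ j)) ?muln_gt0 ?V0 //; lia.
    have h2 : k ^ i * l ^ j * ((l ^ (J - j)).+1 * l ^ n) <= k ^ i * l ^ j * (k ^ (I - i) * l ^ n).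
      by rewrite leq_mul2l leq_mul2r h1 !orbT.
    have h3 : l ^ j * (2 * (k ^ I * l ^ n)) <= l ^ j * (2 * (k ^ I * k ^ q) + (2 * k ^ a + 1) * l ^ n).
      by rewrite leq_mul2l up orbT.
    have h4 : l ^ j * l ^ n * (2 * k ^ a + 1) < l ^ j * l ^ n * (2 * k ^ i).
      by rewrite ltn_pmul2l ?muln_gt0 ?W0 //; lia.
    move: h3; rewrite -{1 2}(subnKC (ltnW lt_iI)) !expnD; lia.
  have h1 := expl_lt_double hl lt_Jj.
  have h2 := expk_lt_double hk lt_iI.
  have h3 : k ^ I * l ^ j * l ^ n < k ^ I * l ^ j * (2 * k ^ q).
    by rewrite ltn_pmul2l ?muln_gt0 ?KI.
  have h4 : (2 * k ^ i) * (2 * l ^ J) * l ^ n <= k ^ I * l ^ j * l ^ n by rewrite leq_mul2r leq_mul ?orbT.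
  lia.
- exfalso; move: lt1 lo1 up1; rewrite -(subnKC (ltnW lt_Ii)) ltn_add2l expnD.
  have : 0 < i - I by rewrite subn_gt0.
  set p := i - I => p0 lt_pq lo1 up1; have P0 := K0 p.
  case: (leqP J j) => [le_Jj|lt_jJ].
    move: lo1 up1; rewrite -(subnKC le_Jj) expnD; set m := j - J => lo1 up1.
    have M0 := L0 m.
    have h1 : k ^ q * l ^ m <= k ^ p * l ^ n.
      by rewrite -(@leq_pmul2l (k ^ I * l ^ J)) ?muln_gt0 ?KI //; lia.
    have := noise p m; rewrite p0 lt_pq => /(_ isT h1).
    rewrite -(@leq_pmul2l (l ^ J)) //; lia.
  have h1 := expl_lt_double hl lt_jJ.
  have h2 : k ^ I * k ^ q * (2 * l ^ j) <= k ^ I * k ^ q * l ^ J by rewrite leq_mul2l h1 orbT.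
  have h3 : k ^ I * l ^ J * k ^ q < k ^ I * l ^ J * l ^ n by rewrite ltn_pmul2l // muln_gt0 KI.
  have h4 : 2 * (k ^ I * l ^ J * l ^ n) <= k ^ p * (k ^ I * l ^ J * l ^ n).
    by rewrite leq_mul2r; apply/orP; right; have := expk_lt_double hk p0; rewrite expn0.
  have h5 : 2 * b * (l ^ J * l ^ n) <= k ^ I * (l ^ J * l ^ n) by rewrite leq_mul2r; apply/orP; right; nia.
  lia.
- exists a; rewrite mem_rcons inE; apply/orP; left; subst i.
  suff -> : j = J by [].
  case: (ltngtP j J) => [lt_jJ|lt_Jj|//]; exfalso.
    have h1 := expl_lt_double hl lt_jJ.
    have h2 : k ^ I * k ^ q * (2 * l ^ j) <= k ^ I * k ^ q * l ^ J by rewrite leq_mul2l h1 orbT.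
    have h3 : k ^ I * l ^ J * k ^ q < k ^ I * l ^ J * l ^ n by rewrite ltn_pmul2l // muln_gt0 KI.
    have h5 : 2 * b * (l ^ J * l ^ n) <= k ^ I * (l ^ J * l ^ n) by rewrite leq_mul2r; apply/orP; right; nia.
    lia.
  have h1 := expl_lt_double hl lt_Jj.
  have h2 : k ^ I * k ^ q * (2 * l ^ J) <= k ^ I * k ^ q * l ^ j by rewrite leq_mul2l h1 orbT.
  have h3 : k ^ I * l ^ J * l ^ n < k ^ I * l ^ J * (2 * k ^ q) by rewrite ltn_pmul2l // muln_gt0 KI.
  lia.
Qed.

Lemma exists_approximation s : all (fun a => k ^ a < b) s ->
  exists I J e, approximation I J e /\ [seq t.2 | t <- e] = s.
Proof.
elim/last_ind: s => [_|s a IHs].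
  (* The start is [theta = k ^ i1] with an empty range of indices. *)
  exists i1, 0, [::]; split=> //; split=> //; first by rewrite expn0 muln1.
  by move=> i j /andP[le]; rewrite ltnNge le.
rewrite all_rcons => /andP[ltA /IHs [I [J [e [app <-]]]]].
have [I' [J' app']] := approximation_rcons app ltA.
by exists I', J', (rcons e (I, J, a)); rewrite map_rcons.
Qed.

End Approximation.
End Approximations.

Definition selected (P Q : nat -> Prop) (d B E x : nat) : Prop :=
  P x /\ (B <= x /\ x <= E /\ exists y, Q y /\ y <= x /\ x < y + d).

(** [y] is not shared with [selected]; for the codes built below, [x < y + d] forces it to be the
    same one. A window of width [c] admits at most one multiple of [c] as label. *)
Definition labelled (P Q : nat -> Prop) (c d x u : nat) : Prop :=
  P u /\ c <= u /\ exists y, Q y /\ y + u <= x /\ x < y + u + c /\ x < y + d.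

Lemma map_uniq_inj (T1 T2 : eqType) (f : T1 -> T2) (s : seq T1) :
  uniq (map f s) -> {in s &, injective f}.
Proof.
elim: s => //= x s IHs /andP[x_s /IHs inj] y z.
rewrite !inE => /predU1P[->|ys] /predU1P[->|zs] // eqf; last exact: inj.
- by case/negP: x_s; rewrite eqf map_f.
- by case/negP: x_s; rewrite -eqf map_f.
Qed.

Lemma window_inj c p q x y : y + c * p <= x -> x < y + c * p + c ->
  y + c * q <= x -> x < y + c * q + c -> p = q.
Proof. by move=> h1 h2 h3 h4; case: (ltngtP p q) => // lt; exfalso; nia. Qed.

Section SequenceCoding.
Variables (k l : nat).
Hypotheses (hk : 2 <= k) (hl : 2 <= l).
Hypothesis expn_neq : forall q n, 0 < q -> k ^ q <> l ^ n.

Let K0 := expk_gt0 hk.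
Let L0 := expl_gt0 hl.

(** [theta = k ^ I / l ^ J] exceeds its substitute [l ^ N / c] by a relative error below [1/W]. For
    [i < I] this is too fine to carry [theta * l ^ j] from above [k ^ i] to below it, since that gap
    is at least [1 / l ^ J]; hence no entry is added. On an entry the error is below
    [l ^ j / l ^ J], which the reserve covers. *)
Lemma sequence_coding s : exists M d B E xs,
  [/\ pairwise ltn xs, size xs = size s,
      forall x, selected (powers k) (powers l) d B E x <-> x \in xs
    & forall t u, t < size s ->
        labelled (powers k) (powers l) (k ^ M) d (nth 0 xs t) u
        <-> u = k ^ M * k ^ nth 0 s t].
Proof.
pose b := k ^ (sumn s).+1; pose i1 := 16 * (b * b).
have b0 : 0 < b by apply: K0.
have b_small : 16 * (b * b) <= k ^ i1 by rewrite ltnW // ltn_expl.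
have lt_s : all (fun a => k ^ a < b) s.
  apply/allP => a a_s; rewrite ltn_exp2l // ltnS; elim: s a_s {b i1 b0 b_small} => //= a' s IH.
  by rewrite inE => /predU1P[->|/IH]; rewrite ?leq_addr // => /leq_trans -> //; rewrite leq_addl.
clearbody b i1.
have [I [J [e [[leI leIJ sorted_e labels_e noise_e] es]]]] :=
  exists_approximation hk hl expn_neq b_small b0 lt_s.
have KI := K0 I; have LJ := L0 J.
pose W := k ^ I * l ^ J.
have W0 : 0 < W by rewrite muln_gt0 KI LJ.
(* The bound [I + J * l] on [m] yields [I <= m] and [J <= n], so [k ^ I] and [l ^ J] can be divided
   out. *)
have [m [n [lem lo up]]] := power_ratio_dense hk hl expn_neq (I + J * l) W0 (ltnSn W) W0.
have lt_nm : l ^ n < k ^ m by rewrite -(ltn_pmul2l W0).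
have leJ : J <= n.
  rewrite leqNgt; apply/negP => lt_nJ.
  have h1 : l ^ n.+1 <= l ^ J by rewrite leq_pexp2l // ltnW.
  have h2 : k ^ J <= k ^ m by rewrite leq_pexp2l //; [exact: ltnW|nia].
  have h3 : l ^ J <= k ^ (J * l).
    have h : l <= k ^ l by rewrite ltnW // ltn_expl.
    rewrite mulnC expnM; case: (J) => // J'; by rewrite leq_exp2r.
  have h4 : k ^ (J * l) <= k ^ m by rewrite leq_pexp2l //; [exact: ltnW|lia].
  move: h1; rewrite expnS => h1; have Ln := L0 n.
  have h5 : 2 * l ^ n <= l * l ^ n by rewrite leq_mul2r hl orbT.
  have h6 : W.+1 * (2 * l ^ n) <= W.+1 * k ^ m by rewrite leq_mul2l; apply/orP; right; lia.
  nia.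
pose M := m - I; pose N := n - J; pose c := k ^ M.
have c0 : 0 < c by apply: K0.
have eZ : k ^ m = c * k ^ I by rewrite /c /M -expnD subnK // (leq_trans (leq_addr _ _) lem).
have eX : l ^ n = l ^ N * l ^ J by rewrite -expnD subnK.
have ZX : c * k ^ I < l ^ N * l ^ J + c.
  rewrite -(ltn_pmul2l W0) mulnDr -eX -eZ.
  have : l ^ n < W * c by rewrite (leq_trans lt_nm) // eZ mulnC leq_mul2r; apply/orP; right; apply: leq_pmulr.
  lia.
rewrite eZ eX in lt_nm lo up.
have entryP i j a : (i, j, a) \in e ->
    l ^ (N + j) + c * k ^ a <= c * k ^ i /\ c * k ^ i < l ^ (N + j) + c * k ^ a + c.
  move=> /labels_e[_ lo1 up1]; rewrite expnD; split.
    rewrite -(leq_pmul2r LJ).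
    have : c * (k ^ I * l ^ j + k ^ a * l ^ J) <= c * (k ^ i * l ^ J) by rewrite leq_pmul2l.
    have : l ^ N * l ^ J * l ^ j <= c * k ^ I * l ^ j by rewrite leq_mul2r (ltnW lt_nm) orbT.
    lia.
  rewrite -(ltn_pmul2r LJ); have Lj := L0 j.
  have : c * (k ^ i * l ^ J + 2 * b * l ^ j) <= c * (k ^ I * l ^ j + (k ^ a).+1 * l ^ J) by rewrite leq_pmul2l.
  have : c * k ^ I * l ^ j < (l ^ N * l ^ J + c) * l ^ j by rewrite ltn_pmul2r.
  have : c * l ^ j * 1 <= c * l ^ j * b by rewrite leq_mul2l b0 orbT.
  lia.
have selP i f : i1 <= i < I -> l ^ f <= c * k ^ i -> c * k ^ i < l ^ f + c * b ->
    exists j a, f = N + j /\ (i, j, a) \in e.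
  move=> /andP[le1 lt1] lo1 up1; case: (leqP N f) => [leNf|ltfN].
    move: lo1 up1; rewrite -(subnKC leNf); set j := f - N; rewrite expnD => lo1 up1.
    have Lj := L0 j.
    have [|||a] := noise_e i j; first exact/andP.
    - rewrite leqNgt; apply/negP => lt2.
      have h1 : c * (k ^ i * l ^ J).+1 <= c * (k ^ I * l ^ j) by rewrite leq_mul2l lt2 orbT.
      have h2 : W * (c * k ^ I) * l ^ j < W.+1 * (l ^ N * l ^ J) * l ^ j by rewrite ltn_pmul2r.
      have h3 : W.+1 * l ^ J * (l ^ N * l ^ j) <= W.+1 * l ^ J * (c * k ^ i) by rewrite leq_mul2l lo1 orbT.
      have h4 : W * (c * (k ^ i * l ^ J).+1) <= W * (c * (k ^ I * l ^ j)) by rewrite leq_mul2l h1 orbT.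
      have h5 : c * (k ^ i * l ^ J) <= c * W by rewrite leq_mul2l leq_mul2r leq_pexp2l ?orbT // ltnW.
      lia.
    - rewrite -(ltn_pmul2l c0).
      have : c * k ^ i * l ^ J < (l ^ N * l ^ j + c * b) * l ^ J by rewrite ltn_pmul2r.
      have : l ^ N * l ^ J * l ^ j <= c * k ^ I * l ^ j by rewrite leq_mul2r (ltnW lt_nm) orbT.
      lia.
    by move=> ha; exists j, a.
  exfalso; have h1 := expl_lt_double hl ltfN.
  have h2 : k ^ i1 <= k ^ i by rewrite leq_pexp2l // ltnW.
  have h3 : l ^ N < c * k ^ i1.
    rewrite -(ltn_pmul2r LJ) (leq_trans lt_nm) // -mulnA leq_mul2l leIJ; lia.
  have h4 : b <= b * b by rewrite leq_pmulr.
  have h5 : c * k ^ i1 <= c * k ^ i by rewrite leq_mul2l h2 orbT.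
  have h6 : c * (2 * b) < c * k ^ i1 by rewrite ltn_pmul2l //; lia.
  lia.
have uniq_i : uniq [seq t.1.1 | t <- e].
  by apply: (pairwise_uniq _ sorted_e) => x; rewrite /= ltnn.
have e_inj i j a j' a' : (i, j, a) \in e -> (i, j', a') \in e -> j = j' /\ a = a'.
  by move=> h h'; case: (map_uniq_inj uniq_i h h' erefl) => -> ->.
pose x_of (t : nat * nat * nat) := k ^ (M + t.1.1).
have ltE i : (c * k ^ i <= (k ^ (M + I)).-1) = (i < I).
  have := K0 (M + I); case E: (k ^ (M + I)) => [//|z] _ /=.
  by rewrite -ltnS -E -expnD ltn_exp2l // ltn_add2l.
have geB i : (k ^ (M + i1) <= c * k ^ i) = (i1 <= i).
  by rewrite -expnD leq_exp2l // leq_add2l.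
(* The predecessor turns the closed interval into the half-open range [i1 <= i < I]. *)
exists M, (c * b), (k ^ (M + i1)), (k ^ (M + I)).-1, [seq x_of t | t <- e]; split.
- rewrite pairwise_map; move: sorted_e; rewrite pairwise_map; apply: sub_pairwise => t t' /=.
  by rewrite /x_of ltn_exp2l // ltn_add2l.
- by rewrite size_map -es size_map.
- move=> x; split.
    case=> -[f ->] [geBf [leEf [_ [[g ->] [lo1 up1]]]]].
    have leMf : M <= f.
      by move: geBf; rewrite leq_exp2l // => /(leq_trans (leq_addr _ _)).
    move: geBf leEf lo1 up1; rewrite -(subnKC leMf) (expnD k M (f - M)) geB ltE => ge lt lo1 up1.
    have [|j [a [_ mem]]] := selP _ _ _ lo1 up1; first exact/andP.
    by rewrite -expnD; apply/mapP; exists (f - M, j, a).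
  case/mapP=> -[[i j] a] mem ->; rewrite /x_of /=.
  have [/andP[ge lt] _ _] := labels_e _ _ _ mem; have [lo1 up1] := entryP _ _ _ mem.
  rewrite (expnD k M i); split; first by exists (M + i); rewrite expnD.
  rewrite geB ltE; do 2![split=> //].
  exists (l ^ (N + j)); split; first by exists (N + j).
  have ltA : k ^ a < b by apply: (allP lt_s); rewrite -es; apply/mapP; exists (i, j, a).
  have : c * (k ^ a).+1 <= c * b by rewrite leq_mul2l ltA orbT.
  lia.
move=> t u; rewrite -es size_map => lt_t.
rewrite (nth_map (0, 0, 0)) // (nth_map (0, 0, 0)) //.
have := mem_nth (0, 0, 0) lt_t; case: (nth _ e t) => [[i j] a] mem; rewrite /x_of /=.
have [/andP[ge lt] _ _] := labels_e _ _ _ mem; have [lo1 up1] := entryP _ _ _ mem.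
rewrite expnD -/c; split.
  case=> -[f ->] [lef [_ [[g ->] [lo2 [up2 up3]]]]].
  have leMf : M <= f by move: lef; rewrite leq_exp2l.
  move: lef lo2 up2; rewrite -(subnKC leMf) (expnD k M (f - M)) -/c => lef lo2 up2.
  (* The power of [l] chosen by [labelled] belongs to an entry with index [i], and [e] has only one
     such entry. *)
  have [|||j' [a' [eg mem']]] := selP i g.
  - exact/andP.
  - by apply: leq_trans lo2; apply: leq_addr.
  - exact: up3.
  have [ej _] := e_inj _ _ _ _ _ mem mem'; rewrite eg -ej in lo2 up2.
  by congr (c * _); apply: (window_inj lo2 up2 lo1 up1).
move=> ->; split; first by exists (M + a); rewrite expnD.
split; first by rewrite leq_pmulr.
exists (l ^ (N + j)); split; first by exists (N + j).
have ltA : k ^ a < b by apply: (allP lt_s); rewrite -es; apply/mapP; exists (i, j, a).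
have : c * (k ^ a).+1 <= c * b by rewrite leq_mul2l ltA orbT.
lia.
Qed.

End SequenceCoding.

(** * From finite sequences to finite sets of tuples *)

Section Claims.
Variables (P Q : nat -> Prop) (c d B E : nat).

Definition next_selected (x x' : nat) : Prop :=
  selected P Q d B E x' /\ x < x' /\
  forall z, selected P Q d B E z -> z <= x \/ x' <= z.

Fixpoint reads (x : nat) (us : seq nat) : Prop :=
  if us is u :: us' then
    exists x', next_selected x x' /\ labelled P Q c d x' u /\ reads x' us'
  else True.

(** Only a prefix of a block is read; the rules fix arities, so a prefix of the right length will be
    the whole tuple. *)
Definition claim (us : seq nat) : Prop :=
  exists x, selected P Q d B E x /\ labelled P Q c d x c /\ reads x us.

End Claims.

(* Entries are shifted by one so that [0] can mark the start of a list. *)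
Definition blocks (T : seq (seq nat)) : seq nat :=
  flatten [seq 0 :: map S w | w <- T].

(** Shifted entries are positive: a 0 occurs only where a block starts, and a shifted tuple cannot
    run into the next block. *)
Lemma blocks_prefix T w :
  (exists t, [/\ t < size (blocks T), nth 0 (blocks T) t = 0
                & prefix (map S w) (drop t.+1 (blocks T))]) <-> has (prefix w) T.
Proof.
have prefixS w0 T' : prefix (map S w) (map S w0 ++ blocks T') = prefix w w0.
  elim: w w0 => [|a w IHw] w0; first by rewrite !prefix0s.
  by case: w0 => [|a0 w0] /=; [case: T' {IHw}|rewrite eqSS IHw].
elim: T => [|w0 T IHT]; first by split=> // -[t []].
rewrite (_ : blocks (w0 :: T) = 0 :: map S w0 ++ blocks T) //=; split.
  case=> -[|t] /= [lt e]; first by rewrite drop0 prefixS => ->.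
  move=> pre; apply/orP; right; apply/IHT; exists (t - size w0).
  have le : size w0 <= t.
    rewrite leqNgt; apply/negP => lt'; move: e.
    by rewrite nth_cat size_map lt' (nth_map 0).
  split.
  - by rewrite ltn_subLR // -(size_map S w0) -size_cat.
  - by move: e; rewrite nth_cat size_map ltnNge le.
  - move: pre; rewrite drop_cat size_map ltnNge (leqW le) /= subSn //.
case/orP=> [pre|/IHT[t [lt e pre]]].
  by exists 0; split=> //=; rewrite drop0 prefixS.
exists (size w0 + t).+1; split=> /=.
- by rewrite size_cat size_map !ltnS ltn_add2l.
- by rewrite nth_cat size_map ltnNge leq_addr /= addKn.
- by rewrite drop_cat size_map ltnNge -addnS leq_addr /= addKn.
Qed.

Section ClaimsCoding.
Variables (k l : nat).
Hypotheses (hk : 2 <= k) (hl : 2 <= l).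
Hypothesis expn_neq : forall q n, 0 < q -> k ^ q <> l ^ n.

(** The codes increase along the sequence, so the order recovers positions: [next_selected] leads
    from index [t] to [t.+1]. *)
Lemma claims_coding T : exists c d B E, powers k c /\ forall w,
  claim (powers k) (powers l) c d B E [seq c * k ^ a.+1 | a <- w] <-> has (prefix w) T.
Proof.
set s := blocks T.
have [M [d [B [E [xs [sorted_xs size_xs selP labP]]]]]] := sequence_coding hk hl expn_neq s.
pose c := k ^ M; have c0 : 0 < c by apply: expk_gt0.
exists c, d, B, E; split; first by exists M.
have lt_nth t t' : t < t' -> t' < size xs -> nth 0 xs t < nth 0 xs t'.
  by move=> lt lt'; apply: (pairwiseP 0 sorted_xs) => //; apply: ltn_trans lt lt'.
have nextP t x' : t < size xs -> next_selected (powers k) (powers l) d B E (nth 0 xs t) x' <->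
    t.+1 < size xs /\ x' = nth 0 xs t.+1.
  move=> lt; split.
    case=> /selP/(nthP 0)[t' lt' <-] [ltx between].
    have lt_tt' : t < t'.
      rewrite ltnNge; apply/negP; rewrite leq_eqVlt => /predU1P[e|lt1].
        by move: ltx; rewrite e ltnn.
      by have := ltn_trans ltx (lt_nth _ _ lt1 lt); rewrite ltnn.
    split; first exact: leq_trans lt'.
    case: (ltngtP t.+1 t') => [lt1||->//]; last by rewrite ltnNge lt_tt'.
    have /between[] : selected (powers k) (powers l) d B E (nth 0 xs t.+1).
      by apply/selP; apply: mem_nth; apply: ltn_trans lt1 lt'.
      by rewrite leqNgt lt_nth // (ltn_trans lt1 lt').
    by rewrite leqNgt lt_nth.
  case=> lt1 ->; split; first by apply/selP; apply: mem_nth.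
  split; first exact: lt_nth.
  move=> z /selP/(nthP 0)[t' lt' <-]; case: (leqP t' t) => [le|le].
    left; move: le; rewrite leq_eqVlt => /predU1P[->//|lt2]; exact/ltnW/lt_nth.
  right; move: le; rewrite leq_eqVlt => /predU1P[<-//|lt2]; exact/ltnW/lt_nth.
have readsP us t : t < size s ->
    reads (powers k) (powers l) c d B E (nth 0 xs t) us <->
    prefix us [seq c * k ^ a | a <- drop t.+1 s].
  elim: us t => [|u us IHus] t lt; first by rewrite prefix0s.
  rewrite /=; split.
    case=> x' [/nextP[|lt1 ->]]; rewrite ?size_xs //; rewrite size_xs in lt1 => -[/(labP _ _ lt1) -> /(IHus _ lt1)].
    by rewrite (drop_nth 0 lt1) /= eqxx.
  case: (ltnP t.+1 (size s)) => [lt1|le]; last by rewrite drop_oversize.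
  rewrite (drop_nth 0 lt1) /= => /andP[/eqP-> pre].
  exists (nth 0 xs t.+1); split; first by apply/nextP; rewrite size_xs.
  by split; [apply/labP|apply/IHus].
move=> w; rewrite -blocks_prefix -/s.
have prefixE t : prefix [seq c * k ^ a.+1 | a <- w] [seq c * k ^ a | a <- drop t.+1 s]
    = prefix (map S w) (drop t.+1 s).
  elim: (w) (drop t.+1 s) => [|a w' IHw] [|a' s'] //=; rewrite IHw; congr (_ && _).
  by rewrite eqn_pmul2l // eqn_exp2l.
split.
  case=> x [/selP/(nthP 0)[t lt <-]]; rewrite size_xs in lt => -[/(labP _ _ lt) e /(readsP _ _ lt)].
  rewrite prefixE => pre; exists t; split=> //.
  apply/eqP; rewrite -(eqn_exp2l _ _ hk) -(eqn_pmul2l c0) -e; by rewrite muln1.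
case=> t [lt e pre]; exists (nth 0 xs t); split; first by apply/selP/mem_nth; rewrite size_xs.
split; first by apply/labP; rewrite // e expn0 muln1.
by apply/readsP; rewrite // prefixE.
Qed.

End ClaimsCoding.

(** * Definability *)

Section DefinableSets.
Variables P Q : nat -> Prop.

Definition definable_term n (s : (nat -> nat) -> nat) : Prop :=
  exists2 t, term_below n t & forall v, eval v t = s v.

Definition definable n (R : (nat -> nat) -> Prop) : Prop :=
  exists2 phi, free_below n phi & forall v, sat P Q v phi <-> R v.

Lemma definable_term_var n i : i < n -> definable_term n (fun v => v i).
Proof. by move=> lt; exists (Var i). Qed.

Lemma definable_term_add n s t : definable_term n s -> definable_term n t ->
  definable_term n (fun v => s v + t v).
Proof.
move=> [s' bs es] [t' bt et]; exists (Add s' t'); rewrite /= ?bs //.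
by move=> v; rewrite /= es et.
Qed.

Lemma definable_term_ext n s t : s =1 t -> definable_term n s -> definable_term n t.
Proof. by move=> e [u bu eu]; exists u => // v; rewrite eu. Qed.

Lemma definable_term_mul n a s : 0 < a -> definable_term n s ->
  definable_term n (fun v => a * s v).
Proof.
case: a => // a _ ds; elim: a => [|a IHa].
  by apply: definable_term_ext ds => v; rewrite mul1n.
by apply: (definable_term_ext _ (definable_term_add ds IHa)) => v; rewrite [in RHS]mulSn.
Qed.

Fixpoint shift_term t := match t with
  | Var i => Var i.+1
  | Add s t => Add (shift_term s) (shift_term t)
  end.

Lemma definable_term_shift n s : definable_term n s ->
  definable_term n.+1 (fun v => s (fun i => v i.+1)).
Proof.
case=> t bt et; exists (shift_term t).
  by elim: t bt {et} => //= t IHt u IHu /andP[/IHt -> /IHu ->].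
by move=> v; rewrite -et; elim: t {bt et} => //= t -> u ->.
Qed.

Lemma definable_ext n R R' : (forall v, R v <-> R' v) -> definable n R -> definable n R'.
Proof. by move=> e [f bf ef]; exists f => // v; rewrite ef. Qed.

Lemma definable_eq n s t : definable_term n s -> definable_term n t ->
  definable n (fun v => s v = t v).
Proof.
move=> [s' bs es] [t' bt et]; exists (FEq s' t'); rewrite /= ?bs //.
by move=> v; rewrite /= es et.
Qed.

Lemma definable_P n s : definable_term n s -> definable n (fun v => P (s v)).
Proof. by move=> [t bt et]; exists (FP t) => // v; rewrite /= et. Qed.

Lemma definable_Q n s : definable_term n s -> definable n (fun v => Q (s v)).
Proof. by move=> [t bt et]; exists (FQ t) => // v; rewrite /= et. Qed.

Lemma definable_not n R : definable n R -> definable n (fun v => ~ R v).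
Proof. by move=> [f bf ef]; exists (FNot f) => // v; rewrite /= ef. Qed.

Lemma definable_and n R S : definable n R -> definable n S ->
  definable n (fun v => R v /\ S v).
Proof.
move=> [f bf ef] [g bg eg]; exists (FAnd f g); rewrite /= ?bf //.
by move=> v; rewrite /= ef eg.
Qed.

Lemma definable_or n R S : definable n R -> definable n S -> definable n (fun v => R v \/ S v).
Proof.
move=> [f bf ef] [g bg eg]; exists (FOr f g); rewrite /= ?bf //.
by move=> v; rewrite /= ef eg.
Qed.

Lemma definable_imp n R S : definable n R -> definable n S -> definable n (fun v => R v ->
  S v).
Proof.
move=> [f bf ef] [g bg eg]; exists (FImp f g); rewrite /= ?bf //.
by move=> v; rewrite /= ef eg.
Qed.

Lemma definable_all n (R : nat -> (nat -> nat) -> Prop) :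
  definable n.+1 (fun v => R (v 0) (fun i => v i.+1)) ->
  definable n (fun v => forall a, R a v).
Proof.
by move=> [f bf ef]; exists (FAll f) => // v /=; split=> h a; have := h a; rewrite ef.
Qed.

Lemma definable_ex n (R : nat -> (nat -> nat) -> Prop) :
  definable n.+1 (fun v => R (v 0) (fun i => v i.+1)) ->
  definable n (fun v => exists a, R a v).
Proof.
by move=> [f bf ef]; exists (FEx f) => // v /=; split=> -[a h]; exists a; move: h; rewrite ef.
Qed.

Lemma definable_le n s t : definable_term n s -> definable_term n t ->
  definable n (fun v => s v <= t v).
Proof.
move=> ds dt; apply: (@definable_ext _ (fun v => exists z, s v + z = t v)).
  move=> v; split=> [[z <-]|le]; first exact: leq_addr.
  by exists (t v - s v); rewrite subnKC.
apply: (definable_ex (R := fun z v => s v + z = t v)); apply: definable_eq; last exact: definable_term_shift.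
by apply: definable_term_add; [apply: definable_term_shift|apply: definable_term_var].
Qed.

Lemma definable_lt n s t : definable_term n s -> definable_term n t ->
  definable n (fun v => s v < t v).
Proof.
move=> ds dt; apply: (@definable_ext _ (fun v => ~ (t v <= s v))).
  by move=> v; rewrite ltnNge; split=> /negP.
exact/definable_not/definable_le.
Qed.

Lemma definable_selected n d B E x : definable_term n d -> definable_term n B ->
  definable_term n E -> definable_term n x ->
  definable n (fun v => selected P Q (d v) (B v) (E v) (x v)).
Proof.
move=> dd dB dE dx; do ![apply: definable_and]; [exact: definable_P|exact: definable_le|exact: definable_le|].
apply: (definable_ex (R := fun y v => Q y /\ y <= x v /\ x v < y + d v)).
have dy : definable_term n.+1 (fun v => v 0) by apply: definable_term_var.
have dx1 := definable_term_shift dx; have dd1 := definable_term_shift dd.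
do ![apply: definable_and]; [exact: definable_Q|exact: definable_le|].
by apply: definable_lt => //; apply: definable_term_add.
Qed.

Lemma definable_labelled n c d x u : definable_term n c -> definable_term n d ->
  definable_term n x -> definable_term n u ->
  definable n (fun v => labelled P Q (c v) (d v) (x v) (u v)).
Proof.
move=> dc dd dx du; do ![apply: definable_and]; [exact: definable_P|exact: definable_le|].
apply: (definable_ex (R := fun y v => Q y /\ y + u v <= x v /\ x v < y + u v + c v /\ x v < y + d v)).
have dy : definable_term n.+1 (fun v => v 0) by apply: definable_term_var.
have dx1 := definable_term_shift dx; have dd1 := definable_term_shift dd.
have du1 := definable_term_shift du; have dc1 := definable_term_shift dc.
do ![apply: definable_and]; [exact: definable_Q| | |].
- by apply: definable_le => //; apply: definable_term_add.
- by apply: definable_lt => //; do 2![apply: definable_term_add => //].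
- by apply: definable_lt => //; apply: definable_term_add.
Qed.

Lemma definable_next_selected n d B E x x' :
  definable_term n d -> definable_term n B -> definable_term n E -> definable_term n x ->
  definable_term n x' ->
  definable n (fun v => next_selected P Q (d v) (B v) (E v) (x v) (x' v)).
Proof.
move=> dd dB dE dx dx'; apply: definable_and; [exact: definable_selected|apply: definable_and; first exact: definable_lt].
apply: (definable_all (R := fun z v => selected P Q (d v) (B v) (E v) z -> z <= x v \/ x' v <= z)).
have dz : definable_term n.+1 (fun v => v 0) by apply: definable_term_var.
apply: definable_imp; first by apply: definable_selected => //; apply: definable_term_shift.
by apply: definable_or; apply: definable_le => //; apply: definable_term_shift.
Qed.

Lemma definable_reads n c d B E x us :
  definable_term n c -> definable_term n d -> definable_term n B -> definable_term n E ->
  definable_term n x ->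
  (forall u, List.In u us -> definable_term n u) ->
  definable n (fun v => reads P Q (c v) (d v) (B v) (E v) (x v) [seq u v | u <- us]).
Proof.
(* Induction on the length, because the tail is shifted under the quantifier and so is not a
   sublist. *)
have [N sz] := ubnP (size us); elim: N us sz n c d B E x => // N IHN [|u us] /=.
  move=> _ n c d B E x dc *; apply: (@definable_ext _ (fun v => c v = c v)) => //; exact: definable_eq.
rewrite ltnS => sz n c d B E x dc dd dB dE dx dus.
have du : definable_term n u by apply: dus; left.
apply: (definable_ex (R := fun x' v => next_selected P Q (d v) (B v) (E v) (x v) x' /\
  labelled P Q (c v) (d v) x' (u v) /\
  reads P Q (c v) (d v) (B v) (E v) x' [seq u v | u <- us])).
have dz : definable_term n.+1 (fun v => v 0) by apply: definable_term_var.
apply: definable_and; first by apply: definable_next_selected => //; apply: definable_term_shift.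
apply: definable_and; first by apply: definable_labelled => //; apply: definable_term_shift.
pose sh (u : (nat -> nat) -> nat) v := u (fun i => v i.+1).
have dus1 u' : List.In u' [seq sh u | u <- us] -> definable_term n.+1 u'.
  move=> /List.in_map_iff [u1 [<- inu]]; apply: definable_term_shift; apply: dus; by right.
have h : definable n.+1 (fun v => reads P Q (sh c v) (sh d v) (sh B v) (sh E v) (v 0) [seq u v | u <- [seq sh u | u <- us]]).
  by apply: IHN => //; [rewrite size_map|exact: definable_term_shift..].
by apply: definable_ext h => v; rewrite -map_comp.
Qed.

Lemma definable_claim n c d B E us :
  definable_term n c -> definable_term n d -> definable_term n B -> definable_term n E ->
  (forall u, List.In u us -> definable_term n u) ->
  definable n (fun v => claim P Q (c v) (d v) (B v) (E v) [seq u v | u <- us]).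
Proof.
move=> dc dd dB dE dus.
apply: (definable_ex (R := fun x v => selected P Q (d v) (B v) (E v) x /\
  labelled P Q (c v) (d v) x (c v) /\
  reads P Q (c v) (d v) (B v) (E v) x [seq u v | u <- us])).
have dz : definable_term n.+1 (fun v => v 0) by apply: definable_term_var.
apply: definable_and; first by apply: definable_selected => //; apply: definable_term_shift.
apply: definable_and; first by apply: definable_labelled => //; apply: definable_term_shift.
pose sh (u : (nat -> nat) -> nat) v := u (fun i => v i.+1).
have dus1 u' : List.In u' [seq sh u | u <- us] -> definable_term n.+1 u'.
  by move=> /List.in_map_iff [u1 [<- inu]]; apply: definable_term_shift; apply: dus.
have h : definable n.+1 (fun v => reads P Q (sh c v) (sh d v) (sh B v) (sh E v) (v 0) [seq u v | u <- [seq sh u | u <- us]]).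
  by apply: definable_reads => //; apply: definable_term_shift.
by apply: definable_ext h => v; rewrite -map_comp.
Qed.

End DefinableSets.

(** * Formulas about coded numbers *)

Section NumberSort.
Variables (k : nat) (Q : nat -> Prop).
Hypothesis hk : 2 <= k.

(* Formulas speak about numbers [a] through the elements [c * k ^ a.+1], where
   [c] is the first of four parameters that come after the [m] number
   variables; [c * k ^ 0] is the separator of claims. *)
Definition params := nat -> nat.

Definition assignment m (w : nat -> nat) (p : params) : nat -> nat :=
  fun i => if i < m then p 0 * k ^ (w i).+1 else p (i - m).

Definition definable_number m (R : params -> (nat -> nat) -> Prop) : Prop :=
  exists2 R', definable (powers k) Q (m + 4) R' &
    forall p w, powers k (p 0) -> (R' (assignment m w p) <-> R p w).

(** Adding a constant multiplies the code by a fixed power of [k], an iterated sum; adding two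
    variables would multiply two codes, which is no term. *)
Definition number_term m (e : (nat -> nat) -> nat) : Prop :=
  (exists i a, i < m /\ forall w, e w = a + w i) \/ (exists a, forall w, e w = a).

Lemma number_term_var m i : i < m -> number_term m (fun w => w i).
Proof. by left; exists i, 0. Qed.

Lemma number_term_const m a : number_term m (fun w => a).
Proof. by right; exists a. Qed.

Lemma number_term_succ m e : number_term m e -> number_term m (fun w => (e w).+1).
Proof.
case=> [[i [a [lt ew]]]|[a ew]]; [left; exists i, a.+1|right; exists a.+1]; last by move=> w; rewrite ew.
by split=> // w; rewrite ew.
Qed.

Lemma number_term_shift m s e : number_term m e ->
  number_term (s + m) (fun w => e (fun i => w (s + i))).
Proof.
case=> [[i [a [lt ew]]]|[a ew]]; [left; exists (s + i), a|right; exists a] => //.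
by rewrite ltn_add2l.
Qed.

Lemma number_termP m e : number_term m e ->
  exists2 s, definable_term (m + 4) s & forall w p, s (assignment m w p) = p 0 * k ^ (e w).+1.
Proof.
have k0 a : 0 < k ^ a by apply: expk_gt0.
case=> [[i [a [lt ew]]]|[a ew]].
  exists (fun v => k ^ a * v i); first by apply/definable_term_mul => //; apply/definable_term_var/ltn_addr.
  by move=> w p; rewrite /assignment lt ew -addnS expnD mulnCA.
exists (fun v => k ^ a.+1 * v m).
  by apply/definable_term_mul => //; apply/definable_term_var; rewrite -addn1 leq_add2l.
by move=> w p; rewrite /assignment ltnn subnn ew mulnC.
Qed.

Lemma definable_number_ext m R R' : (forall p w, R p w <-> R' p w) ->
  definable_number m R -> definable_number m R'.
Proof. by move=> e [S dS eS]; exists S => // p w cp; rewrite eS. Qed.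

Lemma definable_number_not m R : definable_number m R ->
  definable_number m (fun p w => ~ R p w).
Proof.
by move=> [S dS eS]; exists (fun v => ~ S v); [exact: definable_not|move=> p w cp; rewrite eS].
Qed.

Lemma definable_number_and m R1 R2 : definable_number m R1 -> definable_number m R2 ->
  definable_number m (fun p w => R1 p w /\ R2 p w).
Proof.
move=> [S1 d1 e1] [S2 d2 e2]; exists (fun v => S1 v /\ S2 v); first exact: definable_and.
by move=> p w cp; rewrite e1 // e2.
Qed.

Lemma definable_number_or m R1 R2 : definable_number m R1 -> definable_number m R2 ->
  definable_number m (fun p w => R1 p w \/ R2 p w).
Proof.
move=> [S1 d1 e1] [S2 d2 e2]; exists (fun v => S1 v \/ S2 v); first exact: definable_or.
by move=> p w cp; rewrite e1 // e2.
Qed.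

Lemma definable_number_imp m R1 R2 : definable_number m R1 -> definable_number m R2 ->
  definable_number m (fun p w => R1 p w -> R2 p w).
Proof.
move=> [S1 d1 e1] [S2 d2 e2]; exists (fun v => S1 v -> S2 v); first exact: definable_imp.
by move=> p w cp; rewrite e1 // e2.
Qed.

Lemma definable_number_eq m e f : number_term m e -> number_term m f ->
  definable_number m (fun p w => e w = f w).
Proof.
move=> /number_termP[s ds es] /number_termP[t dt et]; exists (fun v => s v = t v); first exact: definable_eq.
move=> p w [i pi]; rewrite es et; split=> [/eqP|->//].
by rewrite pi eqn_pmul2l ?expk_gt0 // eqn_exp2l // eqSS => /eqP.
Qed.

Lemma definable_number_lt m e f : number_term m e -> number_term m f ->
  definable_number m (fun p w => e w < f w).
Proof.
move=> /number_termP[s ds es] /number_termP[t dt et]; exists (fun v => s v < t v); first exact: definable_lt.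
by move=> p w [i pi]; rewrite es et pi ltn_pmul2l ?expk_gt0 // ltn_exp2l.
Qed.

(** As [c] is a power of [k], the codes [c * k ^ a.+1] are exactly the powers of [k] above [c]; the
    quantifier is relativised to these. *)
Lemma definable_number_ex m (R : nat -> params -> (nat -> nat) -> Prop) :
  definable_number m.+1 (fun p w => R (w 0) p (fun i => w i.+1)) ->
  definable_number m (fun p w => exists a, R a p w).
Proof.
case=> S dS eS; exists (fun v => exists u, powers k u /\ v m < u /\ S (scons u v)).
  apply: (definable_ex (R := fun u v => powers k u /\ v m < u /\ S (scons u v))).
  have dz : definable_term (m + 4).+1 (fun v => v 0) by apply: definable_term_var.
  apply: definable_and; first exact: (@definable_P (powers k)).
  apply: definable_and; first by apply: definable_lt => //; apply: definable_term_var; lia.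
  apply: definable_ext dS => v; suff -> : v = scons (v 0) (fun i => v i.+1) by [].
  by apply: functional_extensionality => -[].
have assignmentS p w a : scons (p 0 * k ^ a.+1) (assignment m w p) = assignment m.+1 (scons a w) p.
  by apply: functional_extensionality => -[|i]; rewrite /assignment /= ?ltnS ?subSS.
move=> p w [i pi]; split.
  case=> _ [[f ->] [lt s]]; move: lt; rewrite /assignment ltnn subnn pi ltn_exp2l // => lt.
  have eu : k ^ f = p 0 * k ^ (f - i.+1).+1 by rewrite pi -expnD; congr (_ ^ _); lia.
  exists (f - i.+1); move: s; rewrite eu assignmentS => /eS; apply; by exists i.
case=> a r; exists (p 0 * k ^ a.+1); split; first by exists (i + a.+1); rewrite expnD pi.
split; first by rewrite /assignment ltnn subnn pi -[X in X < _]muln1 ltn_pmul2l ?expk_gt0 // -(expn0 k) ltn_exp2l.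
by rewrite assignmentS; apply/eS => //; exists i.
Qed.

Lemma definable_number_all m (R : nat -> params -> (nat -> nat) -> Prop) :
  definable_number m.+1 (fun p w => R (w 0) p (fun i => w i.+1)) ->
  definable_number m (fun p w => forall a, R a p w).
Proof.
move=> d; apply: (@definable_number_ext _ (fun p w => ~ exists a, ~ R a p w)).
  move=> p w; split=> [h a|h [a na]]; last exact: na.
  by apply: NNPP => na; apply: h; exists a.
by apply/definable_number_not/(definable_number_ex (R := fun a p w => ~ R a p w))/definable_number_not.
Qed.

Definition number_list m (X : (nat -> nat) -> seq nat) : Prop :=
  exists2 es, (forall e, List.In e es -> number_term m e) & forall w, X w = [seq e w | e <- es].

Lemma number_list_cons m e X : number_term m e -> number_list m X ->
  number_list m (fun w => e w :: X w).
Proof.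
move=> de [es des ees]; exists (e :: es); first by move=> f [<-|/des].
by move=> w; rewrite ees.
Qed.

Lemma number_list_behead m X : number_list m X -> number_list m (fun w => behead (X w)).
Proof.
move=> [es des ees]; exists (behead es).
  by case: es des {ees} => [|e es] //= des f inf; apply: des; right.
by move=> w; rewrite ees behead_map.
Qed.

Lemma number_term_nth m X i : number_list m X -> number_term m (fun w => nth 0 (X w) i).
Proof.
move=> [es des ees].
have [lt|le] := ltnP i (size es); last first.
  by right; exists 0 => w; rewrite ees nth_default // size_map.
have : List.In (nth (fun=> 0) es i) es.
  by elim: es i lt {des ees} => // e es IHes [|i] /=; [left|right; apply: IHes].
move=> /des; case=> [[j [a [ltj ew]]]|[a ew]]; [left; exists j, a; split=> //|right; exists a];
  by move=> w; rewrite ees (nth_map (fun=> 0)).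
Qed.

Lemma number_list_shift m s X : number_list m X ->
  number_list (s + m) (fun w => X (fun i => w (s + i))).
Proof.
move=> [es des ees]; exists [seq (fun w => e (fun i => w (s + i))) | e <- es].
  by move=> f /List.in_map_iff[e [<- /des/number_term_shift]]; apply.
by move=> w; rewrite ees -map_comp.
Qed.

End NumberSort.

(** * Traces of recursive functions *)

Inductive rule : Type :=
  | RZero
  | RSucc
  | RProj of nat
  | RComp of nat & seq nat
  | RPrec of nat & nat
  | RMin of nat.

(* [C j (y :: x)] is the claim that the function number [j] takes the value [y]
   at the arguments [x]. *)
Definition justified (C : nat -> seq nat -> Prop) (j : nat) (r : rule) (x : seq nat) (y : nat) : Prop :=
  match r with
  | RZero => y = 0
  | RSucc => y = (nth 0 x 0).+1
  | RProj i => y = nth 0 x i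
  | RComp f gs => exists ys, size ys = size gs /\
      ((forall t, t < size gs -> C (nth 0 gs t) (nth 0 ys t :: x)) /\ C f (y :: ys))
  | RPrec f g =>
      nth 0 x 0 = 0 /\ C f (y :: behead x) \/
      exists z w, nth 0 x 0 = z.+1 /\
        (C j (w :: z :: behead x) /\ C g (y :: z :: w :: behead x))
  | RMin f => C f (0 :: y :: x) /\ forall z, z < y -> exists w, C f (w.+1 :: z :: x)
  end.

Definition rule_holds (C : nat -> seq nat -> Prop) (j n : nat) (r : rule) : Prop :=
  forall x, size x = n -> forall y, C j (y :: x) -> justified C j r x y.

Lemma justified_mono (C C' : nat -> seq nat -> Prop) j r x y :
  (forall i w, C i w -> C' i w) -> justified C j r x y -> justified C' j r x y.
Proof.
move=> sub; case: r => [||i|f gs|f g|f] //=.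
- by move=> [ys [sz [hg hf]]]; exists ys; split=> //; split=> [t /hg|]; apply: sub.
- by case=> [[e /sub h]|[z [w [e [/sub h /sub h']]]]]; [left|right; exists z, w].
- by move=> [/sub h hz]; split=> // z /hz[w /sub]; exists w.
Qed.

Section DefinableRules.
Variables (k : nat) (Q : nat -> Prop).
Hypothesis hk : 2 <= k.

Definition holds (p : params) (i : nat) (w : seq nat) : Prop :=
  claim (powers k) Q (p 0) (p 1) (p 2) (p 3) [seq p 0 * k ^ a.+1 | a <- i :: w].

Lemma definable_number_holds m i X : number_list m X ->
  definable_number k Q m (fun p w => holds p i (X w)).
Proof.
move=> /(number_list_cons (number_term_const m i)) [es des ees].
have [us [dus eus]] : exists us, (forall u, List.In u us -> definable_term (m + 4) u) /\
    forall w p, [seq u (assignment k m w p) | u <- us] = [seq p 0 * k ^ a.+1 | a <- [seq e w | e <- es]].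
  elim: es des {ees} => [|e es IHes] des; first by exists [::].
  have [|u du eu] := @number_termP k hk m e; first by apply: des; left.
  have [us [dus eus]] := IHes (fun f inf => des f (or_intror inf)).
  exists (u :: us); split; first by move=> u' [<-|/dus].
  by move=> w p; rewrite /= eu eus.
have lt4 t : t < 4 -> definable_term (m + 4) (fun v => v (m + t)).
  by move=> lt; apply: definable_term_var; rewrite ltn_add2l.
exists (fun v => claim (powers k) Q (v (m + 0)) (v (m + 1)) (v (m + 2)) (v (m + 3)) [seq u v | u <- us]).
  by apply: definable_claim => //; apply: lt4.
move=> p w _; rewrite eus -ees /holds /assignment !ltnNge !leq_addr /= !addKn.
by [].
Qed.

(** Descending indices: the head belongs to the outermost quantifier. *)
Fixpoint vars (w : nat -> nat) n := if n is n'.+1 then w n' :: vars w n' else [::].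

Lemma number_list_vars n m : n <= m -> number_list m (fun w => vars w n).
Proof.
elim: n => [|n IHn] lt; first by exists [::].
by apply: number_list_cons; [apply: number_term_var|apply/IHn/ltnW].
Qed.

Lemma definable_number_all_seq n m (R : seq nat -> params -> (nat -> nat) -> Prop) :
  definable_number k Q (n + m) (fun p w => R (vars w n) p (fun i => w (n + i))) ->
  definable_number k Q m (fun p w => forall x, size x = n -> R x p w).
Proof.
elim: n m R => [|n IHn] m R h.
  apply: definable_number_ext h => p w; split=> [h [|//] _|]; last by apply.
  exact: h.
apply: (@definable_number_ext _ _ _ (fun p w => forall a x, size x = n -> R (a :: x) p w)).
  by move=> p w; split=> [h1 [//|a x] [/h1]|h1 a x sz]; [|apply: h1; rewrite /= sz].
apply: (definable_number_all hk (R := fun a p w => forall x, size x = n -> R (a :: x) p w)).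
apply: (IHn m.+1 (fun x p w => R (w 0 :: x) p (fun i => w i.+1))).
rewrite addnS; apply: definable_number_ext h => p w /=; rewrite addn0.
suff -> : (fun i => w (n + i.+1)) = (fun i => w (n.+1 + i)) by [].
by apply: functional_extensionality => i; rewrite addnS.
Qed.

Lemma definable_number_ex_seq n m (R : seq nat -> params -> (nat -> nat) -> Prop) :
  definable_number k Q (n + m) (fun p w => R (vars w n) p (fun i => w (n + i))) ->
  definable_number k Q m (fun p w => exists x, size x = n /\ R x p w).
Proof.
move=> h; apply: (@definable_number_ext _ _ _ (fun p w => ~ forall x, size x = n -> ~ R x p w)).
  move=> p w; split=> [na|[x [sz r]] a]; last exact: a sz r.
  by apply: NNPP => ne; apply: na => x sz r; apply: ne; exists x.
by apply/definable_number_not/(definable_number_all_seq (R := fun x p w => ~ R x p w))/definable_number_not.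
Qed.

Lemma definable_number_true m : definable_number k Q m (fun p w => True).
Proof.
apply: (@definable_number_ext _ _ _ (fun p w => 0 = 0)) => //.
by apply: (definable_number_eq Q hk); apply: number_term_const.
Qed.

(** [N] is external to the formula, so this is a finite conjunction. *)
Lemma definable_number_forall_lt N m (R : nat -> params -> (nat -> nat) -> Prop) :
  (forall t, t < N -> definable_number k Q m (R t)) ->
  definable_number k Q m (fun p w => forall t, t < N -> R t p w).
Proof.
elim: N => [|N IHN] h; first by apply: definable_number_ext (definable_number_true m).
apply: definable_number_ext (definable_number_and (h N (ltnSn N)) (IHN (fun t lt => h t (ltnW lt)))) => p w.
split=> [[hN hlt] t|all_t]; last by split=> [|t lt]; apply: all_t => //; apply: ltnW.
by rewrite ltnS leq_eqVlt => /predU1P[->|/hlt].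
Qed.

Lemma definable_number_justified m j r X e : number_list m X -> number_term m e ->
  definable_number k Q m (fun p w => justified (holds p) j r (X w) (e w)).
Proof.
move=> dX de; case: r => [||i|f gs|f g|f] /=.
- by apply: definable_number_eq => //; apply: number_term_const.
- by apply: definable_number_eq => //; apply/number_term_succ/number_term_nth.
- by apply: definable_number_eq => //; apply/number_term_nth.
- apply: (definable_number_ex_seq (R := fun ys p w =>
    (forall t, t < size gs -> holds p (nth 0 gs t) (nth 0 ys t :: X w)) /\ holds p f (e w :: ys))).
  have dys : number_list (size gs + m) (fun w => vars w (size gs)) by apply/number_list_vars/leq_addr.
  apply: definable_number_and.
    apply: (definable_number_forall_lt (R := fun t p w => holds p (nth 0 gs t)
      (nth 0 (vars w (size gs)) t :: X (fun i => w (size gs + i))))) => t _.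
    by apply/definable_number_holds/number_list_cons; [apply: number_term_nth|apply: number_list_shift].
  by apply/definable_number_holds/number_list_cons => //; apply: number_term_shift.
- apply: definable_number_or.
    apply: definable_number_and; first by apply: definable_number_eq => //; [apply: number_term_nth|apply: number_term_const].
    by apply/definable_number_holds/number_list_cons => //; apply: number_list_behead.
  apply: (definable_number_ex hk (R := fun z p w => exists v, nth 0 (X w) 0 = z.+1 /\
    (holds p j (v :: z :: behead (X w)) /\ holds p g (e w :: z :: v :: behead (X w))))).
  apply: (definable_number_ex hk (R := fun v p w => nth 0 (X (fun i => w i.+1)) 0 = (w 0).+1 /\
    (holds p j (v :: w 0 :: behead (X (fun i => w i.+1))) /\
     holds p g (e (fun i => w i.+1) :: w 0 :: v :: behead (X (fun i => w i.+1)))))).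
  have dX2 := number_list_shift 2 dX; have de2 := number_term_shift 2 de.
  have d0 : number_term m.+2 (fun w => w 0) by apply: number_term_var.
  have d1 : number_term m.+2 (fun w => w 1) by apply: number_term_var.
  apply: definable_number_and.
    apply: (definable_number_eq Q hk (e := fun w => nth 0 (X (fun i => w (2 + i))) 0)); last exact: number_term_succ.
    exact: (number_term_nth _ dX2).
  by apply: definable_number_and; apply/definable_number_holds; repeat (apply: number_list_cons => //); apply: (number_list_behead dX2).
- apply: definable_number_and.
    by apply/definable_number_holds; repeat (apply: number_list_cons => //); apply: number_term_const.
  apply: (definable_number_all hk (R := fun z p w => z < e w -> exists v, holds p f (v.+1 :: z :: X w))).
  apply: definable_number_imp.
    apply: definable_number_lt => //; [exact: number_term_var|exact: (number_term_shift 1 de)].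
  apply: (definable_number_ex hk (R := fun v p w => holds p f (v.+1 :: w 0 :: X (fun i => w i.+1)))).
  apply/definable_number_holds/number_list_cons; first by apply/number_term_succ/number_term_var.
  by apply/number_list_cons; [apply/number_term_var|exact: (number_list_shift 2 dX)].
Qed.

Lemma definable_number_rule_holds m j n r :
  definable_number k Q m (fun p w => rule_holds (holds p) j n r).
Proof.
apply: (definable_number_all_seq (R := fun x p w => forall y, holds p j (y :: x) -> justified (holds p) j r x y)).
apply: (definable_number_all hk (R := fun y p w => holds p j (y :: vars w n) -> justified (holds p) j r (vars w n) y)).
have dX := number_list_shift 1 (number_list_vars (leq_addr m n)).
have d0 : number_term (n + m).+1 (fun w => w 0) by apply: number_term_var.
by apply: definable_number_imp; [apply: definable_number_holds; apply: number_list_cons|apply: definable_number_justified].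
Qed.

End DefinableRules.

Record entry := Entry { arity : nat; value : seq nat -> nat; reason : rule }.

Definition entry0 := Entry 0 (fun=> 0) RZero.

(** Rules refer to smaller indices only, apart from the self-reference in primitive recursion; this
    is what permits induction on [j]. *)
Definition valid (L : seq entry) (j : nat) (n : nat) (F : seq nat -> nat) (r : rule) : Prop :=
  match r with
  | RZero => forall x, size x = n -> F x = 0
  | RSucc => forall x, size x = n -> F x = (nth 0 x 0).+1
  | RProj i => forall x, size x = n -> F x = nth 0 x i
  | RComp f gs =>
      [/\ f < j, arity (nth entry0 L f) = size gs,
          forall g, g \in gs -> g < j /\ arity (nth entry0 L g) = n
        & forall x, size x = n ->
            F x = value (nth entry0 L f) [seq value (nth entry0 L g) x | g <- gs]]
  | RPrec f g =>
      [/\ f < j /\ g < j, n = (arity (nth entry0 L f)).+1, arity (nth entry0 L g) = n.+1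
        & forall x, size x = arity (nth entry0 L f) ->
            F (0 :: x) = value (nth entry0 L f) x /\
            forall y, F (y.+1 :: x) = value (nth entry0 L g) (y :: F (y :: x) :: x)]
  | RMin f =>
      [/\ f < j, arity (nth entry0 L f) = n.+1
        & forall x, size x = n ->
            value (nth entry0 L f) (F x :: x) = 0 /\
            forall y, y < F x -> value (nth entry0 L f) (y :: x) <> 0]
  end.

Definition program (L : seq entry) : Prop :=
  forall j, j < size L -> let e := nth entry0 L j in valid L j (arity e) (value e) (reason e).

Section Programs.
Variable L : seq entry.
Hypothesis programL : program L.
Local Notation ar j := (arity (nth entry0 L j)).
Local Notation va j := (value (nth entry0 L j)).
Local Notation re j := (reason (nth entry0 L j)).

(** Induction on the index, and on the recursion argument for [RPrec]. For [RMin], a claimed value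
    below the minimum would be an earlier zero, and one above it would come with a positive claim at
    the minimum. [C] is arbitrary, as are the parameters. *)
Lemma program_sound (C : nat -> seq nat -> Prop) :
  (forall j, j < size L -> rule_holds C j (ar j) (re j)) ->
  forall j x y, j < size L -> size x = ar j -> C j (y :: x) -> y = va j x.
Proof.
move=> holdsC; elim/ltn_ind => j IH x y ltj szx Cyx.
have lt_trans f : f < j -> f < size L by move=> lt; apply: ltn_trans lt ltj.
have {}IH f x' y' : f < j -> size x' = ar f -> C f (y' :: x') -> y' = va f x'.
  by move=> lt; apply: IH => //; apply: lt_trans.
have val : valid L j (ar j) (va j) (re j) by apply: programL.
have just := holdsC j ltj.
case E: (re j) just val => [||i|f gs|f g|f] /= just val.
- by rewrite val //; apply: just Cyx.
- by rewrite val //; apply: just Cyx.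
- by rewrite val //; apply: just Cyx.
- case: val => ltf arf argss val; rewrite val //.
  have [ys [szy [Cg /(IH _ _ _ ltf) ->]]] := just x szx y Cyx; last by rewrite szy.
  congr (va f _); apply: (@eq_from_nth _ 0); first by rewrite size_map.
  rewrite szy => t ltt; rewrite (nth_map 0) //.
  have [ltg arg] := argss _ (mem_nth 0 ltt).
  by apply: IH ltg _ (Cg t ltt); rewrite arg.
- case: val => -[ltf ltg] arj arg val.
  case: x szx Cyx => [|x0 x]; rewrite arj // => -[szx].
  have [v0 vS] := val x szx.
  elim: x0 y => [|x0 IHx] y Cyx.
    have [[_ Cf]|[z [w [//]]]] := just (0 :: x) (etrans (congr1 S szx) (esym arj)) y Cyx.
    by rewrite v0; apply: IH.
  have [[//]|[z [w [[<-] [Cj Cg]]]]] := just (x0.+1 :: x) (etrans (congr1 S szx) (esym arj)) y Cyx.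
  by rewrite vS -(IHx w Cj); apply: IH => //; rewrite arg arj /= szx.
- case: val => ltf arf val; have [v0 vlt] := val x szx.
  have [Cf Cz] := just x szx y Cyx.
  have e0 : 0 = va f (y :: x) by apply: IH => //; rewrite arf /= szx.
  case: (ltngtP y (va j x)) => // lt; first by case: (vlt y lt).
  have [w Cw] := Cz _ lt.
  have : w.+1 = va f (va j x :: x) by apply: IH => //; rewrite arf /= szx.
  by rewrite v0.
Qed.

Definition supported (T : seq (seq nat)) : Prop :=
  forall v, v \in T -> exists j x y, [/\ v = j :: y :: x, j < size L, size x = ar j
    & justified (fun i w => i :: w \in T) j (re j) x y].

Definition supportable (v : seq nat) : Prop := exists2 T, supported T & v \in T.

Lemma supported_cat T1 T2 : supported T1 -> supported T2 -> supported (T1 ++ T2).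
Proof.
move=> s1 s2 v; rewrite mem_cat => /orP[/s1|/s2] [j [x [y [e lt sz just]]]];
  exists j, x, y; split=> //; apply: justified_mono just => i w;
  by rewrite mem_cat => ->; rewrite ?orbT.
Qed.

Lemma supportable_all (ws : seq (seq nat)) : (forall v, v \in ws -> supportable v) ->
  exists2 T, supported T & {subset ws <= T}.
Proof.
elim: ws => [|v ws IHws] sws; first by exists [::].
have [T1 s1 sub1] : exists2 T, supported T & {subset ws <= T}.
  by apply: IHws => u uws; apply: sws; rewrite inE uws orbT.
have [T2 s2 in2] := sws v (mem_head _ _).
exists (T1 ++ T2); first exact: supported_cat.
by move=> u; rewrite inE mem_cat => /predU1P[->|/sub1 ->]; rewrite ?in2 ?orbT.
Qed.

Lemma supportable_intro j x y (ws : seq (seq nat)) : j < size L -> size x = ar j ->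
  (forall v, v \in ws -> supportable v) ->
  justified (fun i w => i :: w \in ws) j (re j) x y -> supportable (j :: y :: x).
Proof.
move=> ltj szx /supportable_all[T sT subT] just.
exists ((j :: y :: x) :: T); last exact: mem_head.
have mono i w : i :: w \in T -> i :: w \in (j :: y :: x) :: T.
  by move=> h; rewrite inE h orbT.
move=> v; rewrite inE => /predU1P[->|/sT].
  by exists j, x, y; split=> //; apply: justified_mono just => i w /subT/mono.
move=> [j' [x' [y' [e lt sz just']]]]; exists j', x', y'; split=> //.
by apply: justified_mono just'.
Qed.

(** The trace of the evaluation: finitely many traces of the values used are united, and the new
    claim is put in front. *)
Lemma program_complete j x : j < size L -> size x = ar j -> supportable (j :: va j x :: x).
Proof.
elim/ltn_ind: j x => j IH x ltj szx.
have {}IH f x' : f < j -> size x' = ar f -> supportable (f :: va f x' :: x').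
  by move=> lt; apply: IH => //; apply: ltn_trans lt ltj.
have val : valid L j (ar j) (va j) (re j) by apply: programL.
case E: (re j) val => [||i|f gs|f g|f] /= val.
- by apply: (@supportable_intro _ _ _ [::]) => //; rewrite E /= val.
- by apply: (@supportable_intro _ _ _ [::]) => //; rewrite E /= val.
- by apply: (@supportable_intro _ _ _ [::]) => //; rewrite E /= val.
- case: val => ltf arf argss val; set ys := [seq va g x | g <- gs] in val.
  apply: (@supportable_intro _ _ _ ((f :: va f ys :: ys) :: [seq g :: va g x :: x | g <- gs])) => //.
    move=> v; rewrite inE => /predU1P[->|/mapP[g /argss[ltg arg] ->]]; apply: IH => //.
      by rewrite size_map arf.
    by rewrite arg.
  rewrite E /=; exists ys; split; first by rewrite size_map.
  split; last by rewrite val // mem_head.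
  move=> t lt; rewrite inE (nth_map 0) //; apply/orP; right.
  by apply/mapP; exists (nth 0 gs t) => //; apply: mem_nth.
- case: val => -[ltf ltg] arj arg val.
  case: x szx => [|x0 x] szx; first by rewrite arj in szx.
  have {}szx : size x = ar f by move: szx; rewrite arj => -[].
  have [v0 vS] := val x szx.
  elim: x0 => [|x0 IHx].
    apply: (@supportable_intro _ _ _ [:: f :: va f x :: x]) => //=; first by rewrite arj szx.
      by move=> v; rewrite mem_seq1 => /eqP ->; apply: IH.
    by rewrite E /= v0 mem_head; left.
  apply: (@supportable_intro _ _ _ [:: j :: va j (x0 :: x) :: x0 :: x;
    g :: va g (x0 :: va j (x0 :: x) :: x) :: x0 :: va j (x0 :: x) :: x]) => //=.
  - by rewrite arj szx.
  - move=> v; rewrite !inE => /orP[/eqP->//|/eqP->].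
    by apply: IH => //; rewrite arg arj /= szx.
  rewrite E /=; right; exists x0, (va j (x0 :: x)); split=> //.
  by rewrite vS !inE !eqxx orbT.
- case: val => ltf arf val; have [v0 vlt] := val x szx.
  apply: (@supportable_intro _ _ _ ((f :: va f (va j x :: x) :: va j x :: x) ::
    [seq f :: va f (z :: x) :: z :: x | z <- iota 0 (va j x)])) => //.
    by move=> v; rewrite inE => /predU1P[->|/mapP[z _ ->]]; apply: IH => //; rewrite arf /= szx.
  rewrite E /=; split; first by rewrite -v0 mem_head.
  move=> z ltz; exists (va f (z :: x)).-1.
  rewrite prednK ?lt0n; last exact/eqP/vlt.
  rewrite inE; apply/orP; right; apply/mapP; exists z => //.
  by rewrite mem_iota.
Qed.

(** Lengths agree with the arity, so the prefix [j :: y :: x] of a tuple in the trace is all of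
    it. *)
Lemma supported_holds T (C : nat -> seq nat -> Prop) : supported T ->
  (forall i w, C i w <-> has (prefix (i :: w)) T) ->
  forall j, j < size L -> rule_holds C j (ar j) (re j).
Proof.
move=> sT CT j ltj x szx y /CT/hasP[v inT]; have [j' [x' [y' [ev _ szx' just]]]] := sT v inT.
rewrite ev /= => /and3P[/eqP ej /eqP ey]; subst j' y'.
rewrite prefixE szx -szx' take_size => /eqP ex; subst x'.
apply: justified_mono just => i w inw; apply/CT/hasP; exists (i :: w) => //.
exact: prefix_refl.
Qed.

End Programs.

(** * Recursive functions as programs *)

Definition untuple n (h : n.-tuple nat -> nat) (s : seq nat) : nat :=
  oapp h 0 (insub s : option (n.-tuple nat)).

Lemma untupleE n (h : n.-tuple nat -> nat) (x : n.-tuple nat) : untuple h x = h x.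
Proof. by rewrite /untuple valK. Qed.

Lemma tuple_seqP n (x : seq nat) : size x = n -> exists t : n.-tuple nat, x = t.
Proof. by move/eqP=> sz; exists (Tuple sz). Qed.

Definition computes (L : seq entry) (f n : nat) (h : n.-tuple nat -> nat) : Prop :=
  [/\ f < size L, arity (nth entry0 L f) = n
    & forall x : n.-tuple nat, value (nth entry0 L f) x = h x].

Lemma computes_cat L L' f n (h : n.-tuple nat -> nat) :
  computes L f h -> computes (L ++ L') f h.
Proof.
move=> [lt ar va]; split; rewrite ?size_cat ?ltn_addr // nth_cat lt //.
Qed.

Lemma valid_cat L L' j n F r : j <= size L -> valid L j n F r -> valid (L ++ L') j n F r.
Proof.
move=> le; have nthE f : f < j -> nth entry0 (L ++ L') f = nth entry0 L f.
  by move=> lt; rewrite nth_cat (leq_trans lt le).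
case: r => [||i|f gs|f g|f] //= [].
- move=> lf af ag v; rewrite nthE //; split=> // [g /[dup] gin /ag[]|x sz].
    by move=> lg; rewrite nthE.
  rewrite v //; congr (value _ _); apply/eq_in_map => g /ag[lg _].
  by rewrite nthE.
- by move=> [lf lg] ar ag v; rewrite !nthE.
- by move=> lf af v; rewrite nthE.
Qed.

Lemma program_rcons L e : program L -> valid L (size L) (arity e) (value e) (reason e) ->
  program (rcons L e).
Proof.
move=> pL ve j; rewrite size_rcons ltnS leq_eqVlt => /predU1P[->|lt] /=.
  by rewrite nth_rcons ltnn eqxx -cats1; apply: valid_cat.
by rewrite nth_rcons lt -cats1; apply: valid_cat; [apply: ltnW|apply: pL].
Qed.

(** Quantifying over [L] lets the programs of the subfunctions be stacked; appending preserves
    indices and what they compute. *)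
Lemma recursive_program n (h : n.-tuple nat -> nat) : recursive h ->
  forall L, program L -> exists L' f, program (L ++ L') /\ computes (L ++ L') f h.
Proof.
have extend n' (h' : n'.-tuple nat -> nat) L0 L1 r : program (L0 ++ L1) ->
    valid (L0 ++ L1) (size (L0 ++ L1)) n' (untuple h') r ->
    exists L' f, program (L0 ++ L') /\ computes (L0 ++ L') f h'.
  move=> pL va; exists (rcons L1 (Entry n' (untuple h') r)), (size (L0 ++ L1)).
  rewrite -rcons_cat; split; first exact: program_rcons.
  by split; rewrite ?size_rcons ?ltnSn // nth_rcons ltnn eqxx //; apply: untupleE.
elim=> {n h} [n h hE|h hE|n i h hE|m n f g h _ IHf _ IHg hE|n f g h _ IHf _ IHg h0 hS|n f h _ IHf h0 hlt] L pL.
- apply: (extend _ _ L [::] RZero); rewrite cats0 //= => _ /tuple_seqP[x ->].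
  by rewrite untupleE.
- apply: (extend _ _ L [::] RSucc); rewrite cats0 //= => _ /tuple_seqP[x ->].
  by rewrite untupleE hE /thead (tnth_nth 0).
- apply: (extend _ _ L [::] (RProj i)); rewrite cats0 //= => _ /tuple_seqP[x ->].
  by rewrite untupleE hE (tnth_nth 0).
- have [L1 [fi [pL1 cf]]] := IHf L pL.
  have [L2 [gi [pL2 cg]]] : exists L2 (gi : 'I_m -> nat), program (L ++ (L1 ++ L2)) /\
      forall i, i \in enum 'I_m -> computes (L ++ (L1 ++ L2)) (gi i) (g i).
    elim: (enum 'I_m) => [|i s [L2 [gi [pL2 cg]]]].
      by exists [::], (fun=> 0); rewrite cats0.
    have [L3 [f1 [pL3 c1]]] := IHg i _ pL2.
    exists (L2 ++ L3), (fun i' => if i' == i then f1 else gi i').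
    rewrite !catA in pL2 cg pL3 c1 *; split=> // i'; rewrite inE; case: eqP => [->//|_] /= /cg.
    exact: computes_cat.
  have [lf af vf] := computes_cat L2 cf; rewrite -catA in lf af vf.
  apply: (extend _ _ L (L1 ++ L2) (RComp fi [seq gi i | i <- enum 'I_m])) => //=.
  split=> //; first by rewrite size_map size_enum_ord.
    by move=> _ /mapP[i /cg[lg ag _] ->].
  move=> _ /tuple_seqP[x ->]; rewrite untupleE hE -vf; congr (value _ _).
  rewrite -map_comp; apply/eq_in_map => i /cg[_ _ vg]; by rewrite /= vg.
- have [L1 [fi [pL1 cf]]] := IHf L pL.
  have [L2 [gi [pL2 [lg ag vg]]]] := IHg _ pL1.
  have [lf af vf] := computes_cat L2 cf; rewrite -catA in lf af vf pL2 lg ag vg.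
  apply: (extend _ _ L (L1 ++ L2) (RPrec fi gi)) => //=; rewrite af ag; split=> //.
  move=> _ /tuple_seqP[x ->]; split.
    by rewrite vf -h0 -[0 :: x]/(tval (cons_tuple 0 x)) untupleE.
  move=> y; rewrite -[y.+1 :: x]/(tval (cons_tuple y.+1 x)) -[y :: x]/(tval (cons_tuple y x)).
  by rewrite !untupleE hS -vg.
- have [L1 [fi [pL1 [lf af vf]]]] := IHf L pL.
  apply: (extend _ _ L L1 (RMin fi)) => //=; rewrite af; split=> // _ /tuple_seqP[x ->].
  rewrite untupleE; split; first by rewrite -(h0 x) -vf.
  by move=> y /hlt; rewrite -vf.
Qed.

Lemma recursive_const n a : recursive (fun _ : n.-tuple nat => a).
Proof.
elim: a => [|a IHa]; first exact: rec_zero.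
apply: (@rec_comp 1 n (fun x => (thead x).+1) (fun _ _ => a)) => //; first exact: rec_succ.
by move=> x; rewrite /thead tnth_mktuple.
Qed.

Lemma recursive_ext n (f g : n.-tuple nat -> nat) : f =1 g -> recursive f -> recursive g.
Proof. by move=> e; rewrite (functional_extensionality _ _ e). Qed.

Definition recursive1 (f : nat -> nat) := recursive (fun x : 1.-tuple nat => f (thead x)).
Definition recursive2 (f : nat -> nat -> nat) :=
  recursive (fun x : 2.-tuple nat => f (tnth x ord0) (tnth x (lift ord0 ord0))).

Lemma recursive_app1 n f (F : n.-tuple nat -> nat) :
  recursive1 f -> recursive F -> recursive (fun x => f (F x)).
Proof.
move=> rf rF; apply: (rec_comp (g := fun _ => F) rf) => // x.
by rewrite /thead tnth_mktuple.
Qed.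

Lemma recursive_app2 n f (F G : n.-tuple nat -> nat) : recursive2 f ->
  recursive F -> recursive G -> recursive (fun x => f (F x) (G x)).
Proof.
move=> rf rF rG.
apply: (rec_comp (g := fun i : 'I_2 => if i == ord0 then F else G) rf) => [i|x].
  by case: ifP.
by rewrite !tnth_mktuple.
Qed.

Lemma recursive1_S : recursive1 S.
Proof. exact: rec_succ. Qed.

Lemma recursive_tnth n (i : 'I_n) : recursive (fun x : n.-tuple nat => tnth x i).
Proof. exact: rec_proj. Qed.

Lemma recursive2_add : recursive2 addn.
Proof.
apply: (rec_prec (f := fun x => tnth x ord0) (g := fun x => (tnth x (lift ord0 ord0)).+1)).
- exact: recursive_tnth.
- exact: (recursive_app1 recursive1_S (recursive_tnth _)).
- by move=> x; rewrite !(tnth_nth 0).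
- by move=> y x; rewrite !(tnth_nth 0).
Qed.

Lemma recursive1_prec a g f : recursive2 g -> f 0 = a -> (forall y, f y.+1 = g y (f y)) ->
  recursive1 f.
Proof.
move=> rg f0 fS; apply: (rec_prec (recursive_const 0 a) rg).
- by move=> x; rewrite /thead (tnth_nth 0) /= f0.
- by move=> y x; rewrite /thead !(tnth_nth 0) /= fS.
Qed.

Lemma recursive2_cpair : recursive2 cpair.
Proof.
(* Triangular numbers in the form to which [Cantor.to_nat] unfolds, so that the equation below holds
   by computation. *)
pose tri n := nat_rec (fun=> nat) 0 (fun i m => (S i + m)%coq_nat) n.
have rtri : recursive1 tri.
  apply: (@recursive1_prec 0 (fun y z => y.+1 + z)) => //.
  apply: (recursive_app2 recursive2_add); last exact: recursive_tnth.
  exact: (recursive_app1 recursive1_S (recursive_tnth _)).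
apply: (@recursive_ext _ (fun x => tnth x (lift ord0 ord0) +
   tri (tnth x (lift ord0 ord0) + tnth x ord0))) => //.
apply: (recursive_app2 recursive2_add); first exact: recursive_tnth.
by apply: (recursive_app1 rtri); apply: (recursive_app2 recursive2_add); apply: recursive_tnth.
Qed.

(** * Diagonalization *)

Section Instance.
Variable k : nat.
Hypothesis hk : 2 <= k.

Definition mul_term a t := iter a.-1 (Add t) t.

Lemma eval_mul_term a t v : 0 < a -> eval v (mul_term a t) = a * eval v t.
Proof.
case: a => // a _; rewrite /mul_term /=; elim: a => [|a IHa]; first by rewrite mul1n.
by rewrite iterS /= IHa [RHS]mulSn.
Qed.

Definition num_term n := iter n.+1 (mul_term k) (Var 1).

Lemma eval_num_term n v : eval v (num_term n) = k ^ n.+1 * v 1.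
Proof.
have k0 : 0 < k by apply: ltnW.
rewrite /num_term; elim: n.+1 => [|n' IHn]; first by rewrite mul1n.
by rewrite iterS eval_mul_term // IHn expnS mulnA.
Qed.

Lemma num_term_below n : term_below 5 (num_term n).
Proof.
have below a t : term_below 5 t -> term_below 5 (mul_term a t).
  by move=> bt; rewrite /mul_term; elim: a.-1 => //= a' ->; rewrite bt.
by rewrite /num_term; elim: n.+1 => // n' IHn; rewrite iterS below.
Qed.

(** The numeral enters by an equation, not by substitution, which keeps the code a simple function
    of [code phi]. The quantifiers bind [E, B, d, c] from the outside in, so [phi] sees the layout
    of [assignment k 1]. *)
Definition instance (phi : formula) n : formula :=
  FEx (FEx (FEx (FEx (FAnd (FP (Var 0)) (FEx (FAnd (FEq (Var 0) (num_term n)) phi)))))).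

Lemma instance_sentence phi n : free_below 5 phi -> sentence (instance phi n).
Proof. by rewrite /sentence /= num_term_below. Qed.

Lemma sat_instance Q phi R n v : (forall v', sat (powers k) Q v' phi <-> R v') ->
  sat (powers k) Q v (instance phi n) <->
  exists c d B E, powers k c /\
    R (assignment k 1 (fun=> n) (scons c (scons d (scons B (scons E v))))).
Proof.
move=> phiR.
have assignmentE c d B E : assignment k 1 (fun=> n) (scons c (scons d (scons B (scons E v)))) =
    scons (k ^ n.+1 * c) (scons c (scons d (scons B (scons E v)))).
  apply: functional_extensionality => -[|i]; first exact: mulnC.
  by rewrite /assignment ltnS ltn0 subn1.
split.
  move=> [E [B [d [c [Pc [u [/= eu /phiR Ru]]]]]]]; exists c, d, B, E; split=> //.
  by move: Ru; rewrite assignmentE eu eval_num_term.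
move=> [c [d [B [E [Pc Rc]]]]]; exists E, B, d, c; split=> //.
exists (k ^ n.+1 * c); split; first by rewrite /= eval_num_term.
by apply/phiR; rewrite -assignmentE.
Qed.

(** Diagonal function on codes: the formula with code [m] is instantiated at [m] itself. *)
Definition instance_code m :=
  let q z := cpair 8 z in
  q (q (q (q (cpair 4 (cpair (code (FP (Var 0))) (q (cpair 4 (cpair
    (cpair 0 (cpair (code_term (Var 0)) (code_term (num_term m)))) m)))))))).

Lemma code_instance phi : code (instance phi (code phi)) = instance_code (code phi).
Proof. by []. Qed.

Lemma recursive1_instance_code : recursive1 instance_code.
Proof.
have rid : recursive (fun x : 1.-tuple nat => thead x) by apply: recursive_tnth.
have pair F G : recursive F -> recursive G ->
    recursive (fun x : 1.-tuple nat => cpair (F x) (G x)).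
  exact: (recursive_app2 recursive2_cpair).
have rmul : recursive1 (fun z => iter k.-1 (fun y => cpair 1 (cpair z y)) z).
  elim: k.-1 => // a IHa; exact: (pair _ _ (recursive_const 1 1) (pair _ _ rid IHa)).
have rnum : recursive1 (fun m => code_term (num_term m)).
  apply: (@recursive1_prec (code_term (num_term 0))
    (fun _ z => iter k.-1 (fun y => cpair 1 (cpair z y)) z)) => //.
    exact: (recursive_app1 rmul (recursive_tnth _)).
  move=> y; rewrite {1}/num_term iterS -/(num_term y) /mul_term; move: (num_term y) => t.
  by elim: k.-1 => // a IHa; rewrite !iterS /= IHa.
have tagged_pair c F : recursive F -> recursive (fun x : 1.-tuple nat => cpair c (F x)).
  exact: (pair _ _ (recursive_const 1 c)).
by do 8!apply/tagged_pair; apply/pair => //; do 2!apply/tagged_pair.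
Qed.

End Instance.

Theorem theoremB (k l : nat) (hk : 2 <= k) (hl : 2 <= l)
    (hkl : multiplicatively_independent k l) :
  ~ decidable_theory (FO (powers k) (powers l)).
Proof.
move=> [chi rchi chiP].
have expn_neq := indep_expn_neq hk hl hkl.
pose f (x : 1.-tuple nat) := chi [tuple instance_code k (thead x)].
have rf : recursive f.
  apply: (rec_comp (g := fun _ x => instance_code k (thead x)) rchi) => [_|x].
    exact: recursive1_instance_code.
  by congr chi; apply: eq_from_tnth => i; rewrite tnth_mktuple [i]ord1.
have p0 : program [::] by [].
have [L [jf [pL [ltj arj vaj]]]] := recursive_program rf p0; rewrite /= in pL ltj arj vaj.
(* [p] codes claims that obey all rules and include [f (w 0) = 0]. *)
pose R p (w : nat -> nat) := (forall j, j < size L ->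
    rule_holds (holds k (powers l) p) j (arity (nth entry0 L j)) (reason (nth entry0 L j))) /\
  holds k (powers l) p jf [:: 0; w 0].
have [R' [phi bphi ephi] eR] : definable_number k (powers l) 1 R.
  apply: definable_number_and.
    apply: (definable_number_forall_lt hk (R := fun j p w => rule_holds (holds k (powers l) p) j
      (arity (nth entry0 L j)) (reason (nth entry0 L j)))) => j _.
    exact: definable_number_rule_holds.
  apply: (definable_number_holds _ hk); apply: number_list_cons; first exact: number_term_const.
  apply: number_list_cons; first exact: number_term_var.
  by exists [::].
set n := code phi.
have vn : value (nth entry0 L jf) [:: n] = chi [tuple instance_code k n].
  by rewrite -[[:: n]]/(tval [tuple n]) vaj /f /thead (tnth_nth 0).
(* The sentence asserts its own rejection by [chi]. Left to right is soundness; right to left, the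
   trace of the computation at [n] is coded by suitable parameters. *)
have satE v : sat (powers k) (powers l) v (instance k phi n) <-> chi [tuple instance_code k n] = 0.
  rewrite (sat_instance hk _ _ ephi) -vn; split.
    move=> [c [d [B [E [Pc /eR[] // rules cl]]]]].
    by apply/esym; apply: (program_sound pL rules ltj _ cl); rewrite arj.
  move=> v0.
  have [|T sT inT] := program_complete pL (x := [:: n]) ltj; first by rewrite arj.
  have [c [d [B [E [Pc clP]]]]] := claims_coding hk hl expn_neq T.
  exists c, d, B, E; split=> //; apply/eR => //; split.
    by apply: (supported_holds sT) => i w; apply: clP.
  by apply/clP/hasP; exists [:: jf, value (nth entry0 L jf) [:: n] & [:: n]]; rewrite // v0 prefix_refl.
have [c1 c0] := chiP (instance_code k n).
have notFO : ~ FO (powers k) (powers l) (instance k phi n).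
  move=> fo; have /satE e0 := fo.2 (fun=> 0).
  have : chi [tuple instance_code k n] = 1 by apply: c1; exists (instance k phi n).
  by rewrite e0.
have e0 : chi [tuple instance_code k n] = 0.
  (* Injectivity of [code] excludes another true sentence with the same code. *)
  by apply: c0 => -[psi fo]; rewrite -code_instance => /code_inj e; apply: notFO; rewrite e.
by apply: notFO; split; [apply: instance_sentence|move=> v; apply/satE].
Qed.
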